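(* For every graph $G$ and all integers $r\geq 2$ and $k\geq 1$, if $\mathbf{tw}(G)\geq 2^{6r}\cdot k\cdot\log(k+1)$, then $G$ contains $k\cdot\theta_{r}$ as a minor.
   Context: Graphs are finite, undirected, loopless, and may have multiple edges. $\mathbf{tw}(G)$ denotes the treewidth of $G$ (minimum over tree-decompositions of the maximum bag size minus one). $H$ is a minor of $G$ if $H$ can be obtained from $G$ by vertex removals, edge removals and edge contractions (parallel edges arising from contractions are kept, loops are discarded). $\theta_r$ is the graph with two vertices and $r$ parallel edges, and $k\cdot J$ denotes the disjoint union of $k$ copies of a graph $J$. Logarithms are binary. *)

(* Defs.v *)
From mathcomp Require Import all_boot all_order all_algebra.
From mathcomp Require Import boolp reals exp.

Set Implicit Arguments.
Unset Strict Implicit.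
Unset Printing Implicit Defensive.

Import Order.TTheory GRing.Theory Num.Theory.

(* Finite undirected loopless multigraphs: parallel edges are distinct
   elements of [edge] with the same set of endpoints. *)
Record mgraph := MGraph {
  vertex : finType;
  edge : finType;
  ends : edge -> {set vertex};
  card_ends : forall e, #|ends e| = 2
}.

Definition theta (r : nat) : mgraph :=
  @MGraph bool 'I_r (fun=> [set: bool])
    (fun=> etrans (cardsT bool) card_bool).

Section Copies.
Variables (k : nat) (J : mgraph).

Definition copies_ends (e : 'I_k * edge J) : {set 'I_k * vertex J} :=
  [set (e.1, x) | x in ends e.2].

Lemma card_copies_ends e : #|copies_ends e| = 2.
Proof. by rewrite card_imset ?card_ends // => x y []. Qed.

Definition copies : mgraph := MGraph card_copies_ends.

End Copies.

Definition isomorphic (G H : mgraph) : Prop :=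
  exists (f : vertex G -> vertex H) (g : edge G -> edge H),
    [/\ bijective f, bijective g & forall e, ends (g e) = f @: ends e].

(* The three operations, up to isomorphism of the result [H].  The map [g]
   always identifies the edges of [H] with the edges of [G] that survive. *)

Definition removes_vertex (G : mgraph) (v : vertex G) (H : mgraph) : Prop :=
  exists (f : vertex H -> vertex G) (g : edge H -> edge G),
    [/\ injective f /\ (forall x, (x \in codom f) = (x != v)),
        injective g /\ (forall e, (e \in codom g) = (v \notin ends e))
      & forall e, ends (g e) = f @: ends e].

Definition removes_edge (G : mgraph) (d : edge G) (H : mgraph) : Prop :=
  exists (f : vertex H -> vertex G) (g : edge H -> edge G),
    [/\ bijective f,
        injective g /\ (forall e, (e \in codom g) = (e != d))
      & forall e, ends (g e) = f @: ends e].

(* [f] identifies the two ends of [d] and nothing else; the edges that become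
   loops are exactly those with the same ends as [d] (including [d]). *)
Definition contracts_edge (G : mgraph) (d : edge G) (H : mgraph) : Prop :=
  exists (f : vertex G -> vertex H) (g : edge H -> edge G),
    [/\ (forall y, exists x, f x = y)
          /\ (forall x y, f x = f y <-> x = y \/ ends d = [set x; y]),
        injective g /\ (forall e, (e \in codom g) = (ends e != ends d))
      & forall e, ends e = f @: ends (g e)].

Inductive minor (H : mgraph) : mgraph -> Prop :=
| minor_iso G : isomorphic G H -> minor H G
| minor_removes_vertex G (v : vertex G) G' :
    removes_vertex v G' -> minor H G' -> minor H G
| minor_removes_edge G (d : edge G) G' :
    removes_edge d G' -> minor H G' -> minor H G
| minor_contracts_edge G (d : edge G) G' :
    contracts_edge d G' -> minor H G' -> minor H G.

Definition connected_in (T : finType) (e : rel T) (A : {set T}) : Prop :=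
  {in A &, forall s t,
     connect [rel a b | [&& a \in A, b \in A & e a b]] s t}.

(* In a simple graph every cycle has at least three vertices, whereas
   [ucycle] also accepts a single edge traversed back and forth. *)
Definition is_tree (T : finType) (e : rel T) : Prop :=
  [/\ symmetric e, irreflexive e, 0 < #|T|, connected_in e [set: T]
    & forall p : seq T, ucycle e p -> size p <= 2].

Definition tree_decomposition (G : mgraph) (T : finType) (e : rel T)
    (bag : T -> {set vertex G}) : Prop :=
  [/\ is_tree e,
      forall v, exists t, v \in bag t,
      forall d : edge G, exists t, ends d \subset bag t
    & forall v, connected_in e [set t | v \in bag t]].

Definition has_decomposition (G : mgraph) (n : nat) : Prop :=
  exists (T : finType) (e : rel T) (bag : T -> {set vertex G}),
    tree_decomposition e bag /\ \max_(t : T) #|bag t| = n.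

Lemma has_decomposition_ex (G : mgraph) :
  exists n, `[< has_decomposition G n >].
Proof.
exists #|[set: vertex G]|; apply/asboolP.
exists unit, (fun _ _ => false), (fun=> [set: vertex G]); split; last first.
  by rewrite (big_pred1 tt) // => -[].
split.
- split=> //; first by rewrite card_unit.
    by move=> [] [] _ _; apply: connect0.
  by case=> [|x [|y p]] //= /andP[].
- by move=> v; exists tt; rewrite inE.
- by move=> d; exists tt; apply: subsetT.
- by move=> v [] [] _ _; apply: connect0.
Qed.

(* Integer-valued, so that the graph without vertices has treewidth -1. *)
Definition tw (G : mgraph) : int := ((ex_minn (has_decomposition_ex G))%:Z - 1)%R.

Definition log2 (R : realType) (x : R) : R := (ln x / ln 2)%R.

(* Main.v *)
Require Import Defs.
From mathcomp Require Import all_boot all_order all_algebra.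
From mathcomp Require Import boolp reals exp.
From mathcomp Require Import zify.

(** The treewidth and the existence of [k] disjoint copies of [theta_r] only
    depend on adjacency, up to keeping one edge in each parallel class, so the
    argument takes place in a simple graph given by a symmetric relation.
    There a copy of [theta_r] is a pair of disjoint connected sets joined by at
    least [r] edges.  Write [q = r - 1] and let [b] be of order [q ^ 3].

    By induction on [k], a graph without [k] disjoint thetas has a
    tree-decomposition with bags of size [O(b * k * log k)].  Among all
    partitions of the vertices into connected pieces that have at most [b]
    vertices with a neighbour outside, and a tree-decomposition with bags of
    size at most [2 * b] where one bag contains those boundary vertices, take
    one with fewest parts (coarsest_partition).  If [Q] is a set of [O(log k)]
    pieces whose union contains a theta, delete the boundaries of these pieces:
    this costs [b * #|Q|] vertices, cuts the interiors of the pieces off, and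
    leaves a graph without [k - 1] disjoint thetas outside the pieces, to which
    the induction hypothesis applies (decomposition_of_no_packing).

    It remains to find [k] disjoint thetas when every theta spreads over many
    pieces.  Two adjacent pieces cannot be merged, so their union has more than
    [b] boundary vertices; as fewer than [r] edges join it to any third piece,
    two adjacent pieces have [6 * q ^ 2] neighbouring pieces in all.  In the
    quotient graph the vertices of low degree are therefore independent, and
    absorbing each into a neighbour of high degree gives a graph where all
    vertices with a neighbour have degree at least [3 * q]
    (packs_of_heavy_edges).  In such a graph, breadth-first search trees double
    their size at each level, for otherwise some vertex is adjacent to [r]
    vertices of its own tree that are not deeper than itself, which gives a
    theta of logarithmic size.  So a partition into trees of depth [O(log k)],
      grown
    from centres that are far apart, has parts with at least [2 ^ d] outgoing
    edges, again with fewer than [r] edges between two parts: contracting the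
    parts yields a simple graph of minimum degree at least [k * (r + 2)]
    (packs_of_no_small_theta).  Such a graph splits into [k] disjoint subgraphs
    of minimum degree [r] (split_mindeg), each of which contains a theta
    (theta_of_mindeg). *)

Set Implicit Arguments.
Unset Strict Implicit.
Unset Printing Implicit Defensive.

(** * Connected vertex sets *)

Section Connectivity.
Variables (T : finType) (e : rel T).
Implicit Types (A B P : {set T}).

(** Connectivity as an induction principle: only closed sets matter, so paths
    are never manipulated below. *)
Lemma connectedP A :
  connected_in e A <->
  forall P s, s \in A -> s \in P ->
    (forall x y, x \in A -> y \in A -> x \in P -> e x y -> y \in P) ->
    A \subset P.
Proof.
split=> [cA P s sA sP closP | indA s t sA tA].
  apply/subsetP=> t tA; have /connectP[p] := cA s t sA tA.
  elim: p s sA sP => [|y p IHp] x xA xP /=; first by move=> _ ->.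
  by case/andP=> /and3P[_ yA exy]; apply: IHp => //; apply: closP exy.
have /subsetP/(_ t tA) : A \subset
    [set y | connect [rel a b | [&& a \in A, b \in A & e a b]] s y].
  apply: indA sA _ _ => [|x y xA yA]; rewrite !inE ?connect0 // => sx exy.
  by apply: connect_trans sx _; apply: connect1; rewrite /= xA yA.
by rewrite inE.
Qed.

Lemma connected1 x : connected_in e [set x].
Proof. by move=> s t /set1P-> /set1P->; apply: connect0. Qed.

Lemma connectedU A B x : symmetric e ->
  connected_in e A -> connected_in e B -> 
  x \in A -> (x \in B \/ exists2 y, y \in B & e x y) ->
  connected_in e (A :|: B).
Proof.
move=> sym_e /connectedP cA /connectedP cB xA xB; apply/connectedP.
move=> P s sAB sP closP.
have sA t : t \in A -> t \in P -> A \subset P.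
  move=> tA tP; apply: cA tA tP _ => y z yA zA; apply: closP.
    by rewrite inE yA.
  by rewrite inE zA.
have sB t : t \in B -> t \in P -> B \subset P.
  move=> tB tP; apply: cB tB tP _ => y z yB zB; apply: closP.
    by rewrite inE yB orbT.
  by rewrite inE zB orbT.
rewrite subUset; case/setUP: sAB => [sA' | sB'].
  have /subsetP AP := sA s sA' sP; have xP := AP x xA.
  rewrite (sA x) //=; case: xB => [xB|[y yB exy]]; first exact: (sB x).
  by apply: (sB y) => //; apply: closP xP exy; rewrite inE ?xA ?yB ?orbT.
have /subsetP BP := sB s sB' sP.
rewrite (sB s) // andbT; case: xB => [xB|[y yB exy]].
  by apply: (sA x) => //; apply: BP.
apply: (sA x) => //; apply: (closP y); rewrite ?inE ?xA ?yB ?orbT //.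
  exact: BP.
by rewrite sym_e.
Qed.

End Connectivity.

Lemma connected_extend (T : finType) (e : rel T) (A X : {set T}) :
    symmetric e -> connected_in e A ->
    (forall x, x \in X -> x \in A \/ exists2 y, y \in A & e y x) ->
  connected_in e (A :|: X).
Proof.
move=> sym_e /connectedP cA AX; apply/connectedP=> P s sAX sP closP.
have [t tA tP] : exists2 t, t \in A & t \in P.
  case/setUP: (sAX) => [sA|/AX[sA|[y yA eys]]]; [by exists s|by exists s|].
  by exists y => //; apply: (closP s); rewrite ?sAX ?inE ?yA // sym_e.
have /subsetP AP : A \subset P.
  apply: (cA P t) => // x y xA yA; apply: closP; by rewrite inE ?xA ?yA.
rewrite subUset; apply/andP; split; apply/subsetP=> x xAX; first exact: AP.
have [xA|[y yA yx]] := AX x xAX; first exact: AP.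
by apply: (closP y); rewrite ?inE ?yA ?xAX ?orbT ?AP.
Qed.

(** * Minors from families of branch sets *)

Section Models.

Definition adj (G : mgraph) : rel (vertex G) :=
  [rel x y | [exists d : edge G, ends d == [set x; y]]].

Lemma adjP G x y : reflect (exists d : edge G, ends d = [set x; y]) (adj x y).
Proof. by apply: (iffP existsP) => -[d /eqP]; exists d => //; apply/eqP. Qed.

Lemma adj_sym G : symmetric (@adj G).
Proof.
move=> x y; apply/adjP/adjP => -[d dE]; exists d; rewrite dE setUC //.
Qed.

Lemma adj_irr G : irreflexive (@adj G).
Proof.
move=> x; apply/negbTE/negP => /adjP[d dE].
by have := card_ends d; rewrite dE setUid cards1.
Qed.

Section DeleteVertex.
Variables (G : mgraph) (v : vertex G).

Definition del_vertex_type : finType := {x : vertex G | x != v}.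
Definition del_edge_type : finType := {d : edge G | v \notin ends d}.
Definition del_ends (d : del_edge_type) : {set del_vertex_type} :=
  [set x | val x \in ends (val d)].

Lemma val_del_ends d : val @: del_ends d = ends (val d).
Proof.
apply/setP=> x; apply/imsetP/idP => [[y]|xd]; first by rewrite inE => ? ->.
have xv : x != v.
  by apply/eqP=> xv; move: xd; rewrite xv (negbTE (valP d)).
by exists (Sub x xv); rewrite ?inE SubK.
Qed.

Lemma card_del_ends d : #|del_ends d| = 2.
Proof.
by rewrite -(card_ends (val d)) -val_del_ends card_imset //; apply: val_inj.
Qed.

Definition del_vertex := MGraph card_del_ends.

Lemma removes_del_vertex : removes_vertex v del_vertex.
Proof.
exists (val : del_vertex_type -> _), (val : del_edge_type -> _); split.
- split=> [|x]; first exact: val_inj.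
  apply/codomP/idP => [[[y yP] ->]|xv]; first exact: yP.
  by exists (Sub x xv); rewrite SubK.
- split=> [|d]; first exact: val_inj.
  apply/codomP/idP => [[[y yP] ->]|vd]; first exact: yP.
  by exists (Sub d vd); rewrite SubK.
- by move=> d; rewrite -val_del_ends.
Qed.

Lemma adj_del_vertex (x y : vertex del_vertex) :
  adj (val x) (val y) -> adj x y.
Proof.
case/adjP=> d dE; apply/adjP.
have vd : v \notin ends d.
  by rewrite dE !inE negb_or !(eq_sym v) (valP x) (valP y).
exists (Sub d vd : del_edge_type); apply/setP=> z.
by rewrite !inE /= dE !inE.
Qed.

End DeleteVertex.

Section DeleteEdge.
Variables (G : mgraph) (d : edge G).

Definition del_edge :=
  @MGraph (vertex G) {d' : edge G | d' != d} (fun d' => ends (val d'))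
    (fun d' => card_ends (val d')).

Lemma removes_del_edge : removes_edge d del_edge.
Proof.
exists id, (val : {d' : edge G | d' != d} -> _); split.
- by exists id.
- split=> [|d']; first exact: val_inj.
  apply/codomP/idP => [[[y yP] ->]|vd]; first exact: yP.
  by exists (Sub d' vd); rewrite SubK.
- by move=> d'; rewrite imset_id.
Qed.
End DeleteEdge.

Section ContractEdge.
Variables (G : mgraph) (d : edge G) (u w : vertex G).
Hypothesis dE : ends d = [set u; w].

Lemma contract_neq : u != w.
Proof. by have := card_ends d; rewrite dE cards2; case: eqP. Qed.

(** Contraction is realised on the vertices other than [w], with [w] sent
    to [u]. *)
Definition redirect (x : vertex G) := if x == w then u else x.

Lemma redirect_neq x : redirect x != w.
Proof. by rewrite /redirect; case: (x =P w) => [_|/eqP //]; apply: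
  contract_neq. Qed.

Definition con_vertex_type : finType := {x : vertex G | x != w}.
Definition con_edge_type : finType := {d' : edge G | ends d' != ends d}.
Definition con_map (x : vertex G) : con_vertex_type :=
  Sub (redirect x) (redirect_neq x).
Definition con_ends (d' : con_edge_type) := con_map @: ends (val d').

Lemma con_mapE x y : con_map x = con_map y <-> x = y \/ ends d = [set x; y].
Proof.
have nuw := contract_neq.
split=> [/(congr1 val)|[->//|]].
  rewrite !SubK /redirect.
  case: (x =P w) => [->|_]; case: (y =P w) => [->|_]; try by left.
    by move=> <-; right; rewrite dE setUC.
  by move=> ->; right.
rewrite dE => /setP E; apply: val_inj; rewrite !SubK /redirect.
have := E w; have := E u; rewrite !inE !eqxx orbT (negbTE nuw) /=.
case: (x =P w) => [->|/eqP/negbTE xw]; case: (y =P w) => [->|/eqP/negbTE yw] //.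
- by rewrite (negbTE nuw) => /esym/eqP->.
- by rewrite (negbTE nuw) orbF => /esym/eqP->.
- by rewrite ![w == _]eq_sym xw yw.
Qed.

Lemma card_con_ends d' : #|con_ends d'| = 2.
Proof.
rewrite card_in_imset ?card_ends // => x y xd yd /con_mapE[] // E.
case: (eqVneq x y) => // nxy; case/eqP: (valP d').
have /eqP : [set x; y] == ends (val d').
  rewrite eqEcard card_ends cards2 nxy andbT.
  by apply/subsetP=> z; rewrite !inE => /orP[] /eqP->.
by move=> <-; rewrite -E.
Qed.

Definition contract := MGraph card_con_ends.

Lemma contracts_contract : contracts_edge d contract.
Proof.
exists con_map, (val : con_edge_type -> _); split.
- split=> [y|]; last exact: con_mapE.
  exists (val (y : con_vertex_type)); apply: val_inj; rewrite SubK /redirect.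
  by rewrite (negbTE (valP (y : con_vertex_type))).
- split=> [|d']; first exact: val_inj.
  apply/codomP/idP => [[[y yP] ->]|vd]; first exact: yP.
  by exists (Sub d' vd); rewrite SubK.
- by [].
Qed.

Lemma adj_contract x y :
  adj x y -> con_map x = con_map y \/ adj (con_map x :
    vertex contract) (con_map y).
Proof.
case/adjP=> d' d'E; have [E|nE] := eqVneq (ends d') (ends d).
  by left; apply/con_mapE; right; rewrite -E.
right; apply/adjP; exists (Sub d' nE : con_edge_type).
by rewrite /= /con_ends SubK d'E imsetU1 imset_set1.
Qed.

End ContractEdge.

(** Induction on the size of [G]: delete a vertex outside the branch sets, else
    contract an edge inside a branch set, else the branch sets are singletons
    and it remains to delete the edges outside the image of [g]. *)
Lemma minor_of_model (H G : mgraph) (phi : vertex G -> option (vertex H))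
    (g : edge H -> edge G) :
    (forall y, exists x, phi x = Some y) ->
    (forall y, connected_in (@adj G) [set x | phi x == Some y]) ->
    injective g ->
    (forall d, phi @: ends (g d) = Some @: ends d) ->
  minor H G.
Proof.
have [n] := ubnP (#|vertex G| + #|edge G|).
elim: n => // n IHn in G phi g *; rewrite ltnS => leGn surj conn injg gE.
have [/existsP[v /eqP phiv]|/existsPn allSome] :=
  boolP [exists v, phi v == None].
  apply: (minor_removes_vertex (removes_del_vertex v)).
  have vg d : v \notin ends (g d).
    apply/negP=> /(imset_f phi); rewrite gE phiv.
    by case/imsetP.
  apply: (IHn (del_vertex v) (phi \o val) (fun d => Sub (g d) (vg d))).
  - apply: leq_trans leGn; rewrite -addSn leq_add //; last first.
      by rewrite card_sig; apply: max_card.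
    rewrite card_sig.
    rewrite [X in _ <= X](cardD1 v) add1n ltnS.
    by apply: subset_leq_card; apply/subsetP=> x; rewrite !inE andbT.
  - move=> y; have [x xy] := surj y; have xv : x != v.
      by apply: contra_eq_neq xy => ->; rewrite phiv.
    by exists (Sub x xv : del_vertex_type v).
  - move=> y; apply/connectedP=> P s; rewrite inE /= => sy sP closP.
    have /connectedP/(_ (val @: P) (val s)) := conn y; rewrite inE.
    move/(_ sy (imset_f _ sP)) => sub.
    have {}sub : [set x | phi x == Some y] \subset val @: P.
      apply: sub => a b; rewrite !inE => ay yb /imsetP[a' a'P aE] ab.
      have bv : b != v by apply: contraTneq yb => ->; rewrite phiv.
      apply/imsetP; exists (Sub b bv : del_vertex_type v); last by rewrite SubK.
      apply: (closP a'); rewrite ?inE /= -?aE ?SubK //.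
      by apply: (@adj_del_vertex G v); rewrite SubK -aE.
    apply/subsetP=> x; rewrite inE /= => xy.
    have /(subsetP sub)/imsetP[x' x'P /val_inj->//] :
      val x \in [set x | phi x == Some y].
    by rewrite inE.
  - by move=> d1 d2 /(congr1 val); rewrite !SubK => /injg.
  - move=> d; rewrite -gE imset_comp val_del_ends SubK //.
have [/existsP[d /existsP[u /existsP[w /andP[/eqP dE /eqP uw]]]]|noinner] :=
  boolP [exists d, exists u, exists w, (ends d == [set u;
    w]) && (phi u == phi w)].
  apply: (minor_contracts_edge (contracts_contract dE)).
  have nd d' : ends (g d') != ends d.
    apply/eqP=> E; have := congr1 (fun A : {set vertex G} => #|phi @: A|) E.
    rewrite /= gE card_imset; last by move=> ? ? [].
    by rewrite card_ends dE imsetU1 imset_set1 uw setUid cards1.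
  have phiR x : phi (redirect u w x) = phi x.
    by rewrite /redirect; case: eqP => // ->.
  apply: (IHn (contract dE) (phi \o val) (fun d' => Sub (g d') (nd d'))).
  - apply: leq_trans leGn; rewrite -addSn leq_add //; last first.
      by rewrite card_sig; apply: max_card.
    rewrite card_sig.
    rewrite [X in _ <= X](cardD1 w) add1n ltnS.
    by apply: subset_leq_card; apply/subsetP=> x; rewrite !inE andbT.
  - move=> y; have [x xy] := surj y; exists (con_map dE x).
    by rewrite -[RHS]xy -phiR.
  - move=> y; apply/connectedP=> P s; rewrite inE /= => sy sP closP.
    have /connectedP/(_ (con_map dE @^-1: P) (val s)) := conn y; rewrite inE.
    have conV (x : con_vertex_type w) : con_map dE (val x) = x.
      by apply: val_inj; rewrite SubK /redirect (negbTE (valP x)).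
    rewrite inE conV => /(_ sy sP) sub.
    have {}sub : [set x | phi x == Some y] \subset con_map dE @^-1: P.
      apply: sub => a b; rewrite !inE => ay yb aP ab.
      have [<-//|ab'] := adj_contract dE ab.
      by apply: closP aP ab'; rewrite inE /= phiR.
    apply/subsetP=> x; rewrite inE /= => xy.
    have /(subsetP sub) : val x \in [set x | phi x == Some y] by rewrite inE.
    by rewrite inE conV.
  - by move=> d1 d2 /(congr1 val); rewrite !SubK => /injg.
  - move=> d'; rewrite -gE imset_comp /= /con_ends SubK -imset_comp -imset_comp.
    by apply: eq_imset => x /=; rewrite phiR.
have injphi : injective phi.
  move=> x y xy; case E: (phi x) => [z|]; last first.
    by have := allSome x; rewrite E.
  have /connectedP/(_ [set x] x) := conn z.
  rewrite !inE E => /(_ (eqxx _) (eqxx _)).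
  move=> sub; suff /subsetP/(_ y) : [set x | phi x == Some z] \subset [set x].
    by rewrite !inE -xy E eqxx => /(_ isT)/eqP.
  apply: sub => a b; rewrite !inE => az bz _ /adjP[d dE].
  case/negP: noinner; apply/existsP; exists d; apply/existsP; exists a.
  by apply/existsP; exists b; rewrite dE eqxx (eqP az) (eqP bz) eqxx.
have [/existsP[d dg]|/existsPn allg] := boolP [exists d, d \notin codom g].
  apply: (minor_removes_edge (removes_del_edge d)).
  have gd d' : g d' != d by apply: contraNneq dg => <-; apply: codom_f.
  apply: (IHn (del_edge d) phi (fun d' => Sub (g d') (gd d'))) => //.
  - apply: leq_trans leGn; rewrite -addnS leq_add //.
    rewrite card_sig.
    rewrite [X in _ <= X](cardD1 d) add1n ltnS.
    by apply: subset_leq_card; apply/subsetP=> x; rewrite !inE andbT.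
  - move=> y; apply/connectedP=> P s sy sP closP.
    have /connectedP indy := conn y; apply: indy sy sP _.
    move=> a b ay byy aP /adjP[d' d'E].
    have nd' : d' != d.
      apply: contraNneq noinner => dd; apply/existsP; exists d'.
      apply/existsP; exists a; apply/existsP; exists b.
      by move: ay byy; rewrite !inE d'E eqxx => /eqP-> /eqP->/=.
    apply: closP ay byy aP _; apply/adjP.
    by exists (Sub d' nd' : edge (del_edge d)).
  - by move=> d1 d2 /(congr1 val); rewrite !SubK => /injg.
apply: minor_iso.
have {}allg d : d \in codom g by have := allg d; rewrite negbK.
have phiS x : {y | phi x = Some y}.
  by case E: (phi x) => [y|]; [exists y | have := allSome x; rewrite E].
pose f x := sval (phiS x).
have fE x : phi x = Some (f x) by rewrite /f; case: (phiS x).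
exists f, (fun d => iinv (allg d)); split.
- have choosef y : {x | phi x == Some y}.
    by apply: sigW; have [x xE] := surj y; exists x; rewrite xE.
  exists (fun y => sval (choosef y)) => [x|y].
    by apply: injphi; case: (choosef _) => x' /= /eqP->; rewrite fE.
  by case: (choosef _) => x' /= /eqP; rewrite fE => -[].
- exists g => [d|d]; first by rewrite f_iinv.
  by apply: injg; rewrite f_iinv.
- move=> d; have [d' ->] : exists d', d = g d' by apply/codomP.
  rewrite iinv_f //.
  have injS : injective (@Some (vertex H)) by move=> ? ? [].
  apply: (imset_inj injS); rewrite -gE -imset_comp.
  by apply: eq_imset => x; rewrite fE.
Qed.

End Models.

(** * Packings of theta graphs in a simple graph *)

Section Theta.
Variables (r : nat) (V : finType).
Implicit Types (e : rel V) (A B W : {set V}).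

Definition cross e A B : {set V * V} :=
  [set p | [&& p.1 \in A, p.2 \in B & e p.1 p.2]].

(** A model of [theta_r] with branch sets [A] and [B]. *)
Definition theta_on e A B : Prop :=
  [/\ connected_in e A, connected_in e B, [disjoint A & B]
    & r <= #|cross e A B|].

Fixpoint packs e k W : Prop :=
  if k is k'.+1 then exists A B,
    [/\ A \subset W, B \subset W, theta_on e A B
      & packs e k' (W :\: (A :|: B))]
  else True.

Lemma packs_sub e k W W' : W \subset W' -> packs e k W -> packs e k W'.
Proof.
elim: k W W' => // k IHk W W' sWW' [A [B [AW BW thAB pk]]].
exists A, B; split=> //; try exact: subset_trans sWW'.
by apply: IHk pk; apply: setSD.
Qed.

(** The recursion in [packs] is convenient for induction; branch sets indexed
    by [i < k] and a boolean are what a minor model needs. *)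
Lemma packs_family e k W : packs e k W ->
  exists A : nat -> bool -> {set V}, 
    [/\ forall i b, i < k -> A i b \subset W,
        forall i, i < k -> theta_on e (A i true) (A i false)
      & forall i j x b c, i < k -> j < k -> x \in A i b -> x \in A j c ->
          i = j /\ b = c].
Proof.
elim: k W => [|k IHk] W /=; first by exists (fun _ _ => set0).
case=> A [B [AW BW thAB /IHk[F [FW Fth Fdis]]]].
exists (fun i b => if i is i'.+1 then F i' b else if b then A else B).
have notF i b x : i < k -> x \in F i b -> (x \in A) || (x \in B) = false.
  move=> ik /(subsetP (FW i b ik)); rewrite !inE => /andP[/negbTE] //.
split.
- move=> [|i] [] //; rewrite ltnS => /FW sub; apply: subset_trans (sub _) _;
  exact: subsetDl.
- by move=> [|i] //; rewrite ltnS => /Fth.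
move=> [|i] [|j] x b c; rewrite ?ltnS => ik jk.
- case: thAB => _ _ /pred0P/(_ x) /= dis _.
  by case: b c => [] [] xb xc //; move: dis; rewrite xb xc.
- move=> xb xc; have := notF _ _ _ jk xc.
  by case: b xb => ->; rewrite ?orbT.
- move=> xb xc; have := notF _ _ _ ik xb.
  by case: c xc => ->; rewrite ?orbT.
- by move=> xb xc; have [-> ->] := Fdis i j x b c ik jk xb xc.
Qed.

End Theta.

Lemma minor_of_packing (G : mgraph) r k : 0 < r ->
  packs r (@adj G) k [set: vertex G] -> minor (copies k (theta r)) G.
Proof.
move=> r_gt0 /packs_family[A [_ thA disA]].
have disA' (i j : 'I_k) b c x : x \in A i b -> x \in A j c -> (i, b) = (j, c).
  move=> xi xj; have [ij ->] := disA _ _ _ _ _ (ltn_ord i) (ltn_ord j) xi xj.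
  by congr (_, _); apply: val_inj.
pose phi (x : vertex G) := [pick ib : 'I_k * bool | x \in A ib.1 ib.2].
have phiP (i : 'I_k) b x : (phi x == Some (i, b)) = (x \in A i b).
  rewrite /phi; case: pickP => [[j c] /= xj|none]; last by rewrite (none (i,
    b)).
  apply/eqP/idP => [[<- <-] //|xi].
  by congr Some; apply: disA' xj xi.
pose C (i : 'I_k) := cross (@adj G) (A i true) (A i false).
have sizeC i : r <= size (enum (C i)).
  by rewrite -cardE; case: (thA i (ltn_ord i)).
have edgeC (i : 'I_k) (j : 'I_r) : {p : vertex G * vertex G * edge G |
    [/\ p.1 = nth p.1 (enum (C i)) j, p.1.1 \in A i true, p.1.2 \in A i false 
      & ends p.2 = [set p.1.1; p.1.2]]}.
  have jC : j < size (enum (C i)) by apply: leq_trans (sizeC i).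
  case E: (enum (C i)) jC => [//|p0 s]; rewrite -E => jC.
  have := mem_nth p0 jC; rewrite mem_enum inE => /and3P[pA pB /adjP dex].
  have [d dE] := cid dex.
  by exists (nth p0 (enum (C i)) j, d); split=> //=; apply: set_nth_default.
pose g (ij : 'I_k * 'I_r) : edge G := (sval (edgeC ij.1 ij.2)).2.
have gE ij : phi @: ends (g ij) = [set Some (ij.1, b) | b : bool].
  rewrite /g; case: (edgeC _ _) => [[[x y] d]] /= [_ xA yB ->].
  rewrite imsetU1 imset_set1; apply/eqP.
  move: xA yB; rewrite -!phiP => /eqP-> /eqP->; apply/eqP/setP=> z.
  apply/set2P/imsetP => [[]-> |[[] _ ->]]; by [exists true|exists
    false|left|right].
apply: (@minor_of_model (copies k (theta r)) G phi g).
- move=> [i b]; have [_ _ _] := thA i (ltn_ord i).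
  move=> /(leq_trans r_gt0)/card_gt0P[p]; rewrite inE => /and3P[pA pB _].
  by case: b; [exists p.1|exists p.2]; apply/eqP; rewrite phiP.
- move=> [i b].
  have -> : [set x | phi x == Some (i, b)] = A i b.
    by apply/setP=> x; rewrite inE phiP.
  by have [cA cB _ _] := thA i (ltn_ord i); case: b.
- move=> [i j] [i' j'] gg.
  have ii' : i = i'.
    have := congr1 (fun d : edge G => phi @: ends d) gg; rewrite !gE.
    move=> /setP/(_ (Some (i, true))); rewrite imset_f // => /esym/imsetP.
    by case=> b _ [].
  subst i'; congr (_, _); apply: val_inj; move: gg; rewrite /g /=.
  case: (edgeC i j) => [[[x y] d]] /= [pE xA yB dE].
  case: (edgeC i j') => [[[x' y'] d']] /= [pE' xA' yB' dE'] dd'.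
  have xx' : x = x' /\ y = y'.
    have : x \in [set x'; y'] by rewrite -dE' -dd' dE !inE eqxx.
    have : y \in [set x'; y'] by rewrite -dE' -dd' dE !inE eqxx orbT.
    have nAB z : z \in A i true -> z \in A i false -> False.
      by move=> za zb; have := disA' i i true false z za zb.
    case/set2P=> [yx'|->]; case/set2P=> [->|xy'] //.
    + by case: (nAB x'); rewrite // -yx'.
    + by case: (nAB x'); rewrite // -yx'.
    + by case: (nAB x); rewrite // xy'.
  case: xx' pE' => <- <- pE'; apply/eqP.
  rewrite -(nth_uniq (x, y) _ _ (enum_uniq (C i))) ?(leq_trans _ (sizeC i)) //.
  by rewrite -pE -pE'.
- move=> [i j]; rewrite gE /= /copies_ends -imset_comp.
  by apply/setP=> z; apply/imsetP/imsetP => -[b _ ->]; exists b; rewrite ?inE.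
Qed.

(** * Quotients with connected fibres *)

Section Quotient.
Variables (r : nat) (V : finType) (e : rel V) (c : V -> V).
Implicit Types (A B W : {set V}).

(** The graph obtained by contracting the fibres of [c], where a fibre is named
    by its image in [V]; elements outside the image of [c] are isolated. *)
Definition qrel : rel V :=
  [rel i j | (i != j) && [exists x, exists y, [&& c x == i, c y == j & e x y]]].

Lemma qrelP i j :
  reflect (i != j /\ exists x y, [/\ c x = i, c y = j & e x y]) (qrel i j).
Proof.
apply: (iffP andP) => -[ij].
  by case/existsP=> x /existsP[y /and3P[/eqP xi /eqP yj exy]]; split=> //;
    exists x, y.
case=> x [y [xi yj exy]]; split=> //.
by apply/existsP; exists x; apply/existsP; exists y; rewrite xi yj !eqxx.
Qed.

Lemma qrel_sym : symmetric e -> symmetric qrel.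
Proof.
move=> sym_e i j; apply/qrelP/qrelP => -[ij [x [y [xi yj exy]]]];
  by rewrite eq_sym; split=> //; exists y, x; rewrite sym_e.
Qed.

Lemma qrel_irr : irreflexive qrel.
Proof. by move=> i; apply/negbTE/negP => /qrelP[/eqP]. Qed.

Hypothesis conn_fib : forall i, connected_in e (c @^-1: [set i]).

Lemma connected_preim A : connected_in qrel A -> connected_in e (c @^-1: A).
Proof.
move/connectedP=> cA; apply/connectedP=> P s; rewrite inE => sA sP closP.
have fibP x y : x \in P -> c x \in A -> c y = c x -> y \in P.
  move=> xP xA yx; have /connectedP/(_ P x) := @conn_fib (c x).
  rewrite !inE => /(_ (eqxx _) xP) sub.
  suff /subsetP/(_ y) : c @^-1: [set c x] \subset P by rewrite !inE yx eqxx =>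
    ->.
  apply: sub => a b; rewrite !inE => /eqP ax /eqP bx aP eab.
  by apply: closP aP eab; rewrite inE ?ax ?bx.
have sub : A \subset [set c x | x in P].
  apply: (cA _ _ sA); first exact: imset_f.
  move=> i j iA jA /imsetP[x xP ix] /qrelP[_ [a [b [ai bj eab]]]].
  apply/imsetP; exists b => //.
  apply: (closP a) => //; rewrite ?inE ?ai ?bj //.
  by apply: (fibP x); rewrite -?ix.
apply/subsetP=> t; rewrite inE => tA; have /imsetP[x xP tx] := subsetP sub _ tA.
by apply: (fibP x); rewrite -?tx.
Qed.

Lemma card_cross_quotient A B :
  #|cross qrel A B| <= #|cross e (c @^-1: A) (c @^-1: B)|.
Proof.
apply: leq_trans (leq_imset_card (fun p => (c p.1, c p.2)) _).
apply: subset_leq_card; apply/subsetP=> -[i j]; rewrite inE /=.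
case/and3P=> iA jB /qrelP[_ [x [y [xi yj exy]]]].
by apply/imsetP; exists (x, y); rewrite /= ?inE /= ?xi ?yj ?iA ?jB.
Qed.

Lemma theta_on_preim A B :
  theta_on r qrel A B -> theta_on r e (c @^-1: A) (c @^-1: B).
Proof.
case=> cA cB dAB rAB; split; try exact: connected_preim.
  rewrite -setI_eq0 -preimsetI; move: dAB; rewrite -setI_eq0 => /eqP->.
  by rewrite preimset0.
exact: leq_trans rAB (card_cross_quotient A B).
Qed.

Lemma packs_preim k W : packs r qrel k W -> packs r e k (c @^-1: W).
Proof.
elim: k W => //= k IHk W [A [B [AW BW thAB /IHk pk]]].
exists (c @^-1: A), (c @^-1: B); split; try exact: preimsetS.
  exact: theta_on_preim.
by rewrite -preimsetU -preimsetD.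
Qed.

End Quotient.

(** * Packings from large minimum degree *)

Section MinDegree.
Variables (V : finType) (e : rel V).
Hypotheses (sym_e : symmetric e) (irr_e : irreflexive e).
Implicit Types (A B W : {set V}).

Definition deg A x := #|[set y in A | e x y]|.

Definition mindeg d A := (A != set0) && [forall x in A, d <= deg A x].

Lemma mindegP d A :
  reflect (A != set0 /\ forall x, x \in A -> d <= deg A x) (mindeg d A).
Proof. by apply: (iffP andP) => -[A0 /forall_inP]. Qed.

Lemma mindegW d d' A : d' <= d -> mindeg d A -> mindeg d' A.
Proof.
move=> d'd /mindegP[A0 dA]; apply/mindegP; split=> // x /dA; exact: leq_trans.
Qed.

Lemma mindegD1 d A x : mindeg d.+1 A -> mindeg d (A :\ x).
Proof.
move=> /mindegP[A0 dA].
have dx y : y \in A -> d <= deg (A :\ x) y.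
  move=> /dA; rewrite /deg (cardsD1 x) => led.
  have <- : [set z in A | e y z] :\ x = [set z in A :\ x | e y z].
    by apply/setP=> z; rewrite !inE andbA.
  by move: led; case: (x \in _) => // /ltnW.
apply/mindegP; split=> [|y]; last by rewrite inE => /andP[_ /dx].
have [y yA] := set0Pn _ A0; case: (eqVneq y x) yA => [->|yx] yA.
  have /card_gt0P[z] : 0 < deg A x by exact: leq_trans (dA x yA).
  rewrite inE => /andP[zA xz]; apply/set0Pn; exists z; rewrite !inE zA andbT.
  by apply: contraTneq xz => ->; rewrite irr_e.
by apply/set0Pn; exists y; rewrite !inE yx.
Qed.

Definition degenerate d A := [forall B : {set V},
  (B \subset A) ==> ~~ mindeg d B].

Lemma degenerateP d A :
  reflect (forall B : {set V}, B \subset A -> ~~ mindeg d B) (degenerate d A).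
Proof. exact: 'forall_implyP. Qed.

Lemma ndegenerateP d A :
  reflect (exists2 B : {set V}, B \subset A & mindeg d B) (~~ degenerate d A).
Proof.
rewrite negb_forall; apply: (iffP existsP) => -[B].
  by rewrite negb_imply negbK => /andP[]; exists B.
by exists B; rewrite negb_imply negbK; apply/andP.
Qed.

Lemma degenerateS d A B : A \subset B -> degenerate d B -> degenerate d A.
Proof.
move=> AB /degenerateP dB; apply/degenerateP => C CA; apply: dB.
exact: subset_trans AB.
Qed.

Lemma degenerate_low_deg d A : degenerate d.+1 A -> A != set0 ->
  exists2 x, x \in A & deg A x <= d.
Proof.
move=> /degenerateP/(_ A (subxx A)); rewrite negb_and => /orP[/negP //|].
by case/forall_inPn=> x xA; rewrite -ltnNge ltnS; exists x.
Qed.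

Definition cut A B := \sum_(x in A) deg B x.

Lemma degE A x : deg A x = \sum_(y in A) e x y.
Proof.
rewrite /deg -sum1_card big_mkcond [RHS]big_mkcond /=; apply: eq_bigr => y _.
by rewrite inE; case: (y \in A) => //=; case: (e x y).
Qed.

Lemma cutC A B : cut A B = cut B A.
Proof.
rewrite /cut; under eq_bigr do rewrite degE; rewrite exchange_big /=.
by apply: eq_bigr => y _; rewrite degE; apply: eq_bigr => x _; rewrite sym_e.
Qed.

Lemma cut_move A B x : x \in A -> x \notin B ->
  cut (A :\ x) (x |: B) + deg B x = cut A B + deg A x.
Proof.
move=> xA xB.
have -> : deg A x = \sum_(y in A :\ x) e x y.
  by rewrite degE (big_setD1 x xA) /= irr_e.
rewrite {2}/cut (big_setD1 x xA) /= addnC -addnA; congr (_ + _).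
rewrite /cut -big_split /=; apply: eq_bigr => y _.
by rewrite !degE big_setU1 //= sym_e addnC.
Qed.

Lemma deg_setU A B x : [disjoint A & B] -> deg (A :|: B) x = deg A x + deg B x.
Proof. by move=> dis; rewrite !degE -bigU //; apply: eq_bigl => y;
  rewrite !inE. Qed.

Lemma weight_arith a b nA nB c c' dA dB :
  c' + dB = c + dA -> a.+1 + b.+1 <= dA + dB -> dA <= a ->
  c + a.+1 * (1 + nA) + b.+1 * nB <= c' + a.+1 * nA + b.+1 * (1 + nB) -> False.
Proof. rewrite !mulnDr !muln1; lia. Qed.

(** A variant of Stiebitz's theorem on partitions under degree constraints.  If
    no such pair exists, [W] has a partition into an [a.+1]-degenerate part
    and a [b.+1]-degenerate part.  In one of minimal weight, moving a vertex of
    low degree to the other side lowers the weight, so it destroys degeneracy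
    there; doing this from both sides and removing the two moved vertices from
    the dense subsets that appear gives the required pair. *)
Lemma split_mindeg a b W : mindeg (a.+1 + b.+1) W ->
  exists A B : {set V}, [/\ A \subset W, B \subset W, [disjoint A & B],
    mindeg a A
    & mindeg b B].
Proof.
move=> gW; have [W0 dW] := mindegP _ _ gW.
have [//|nosplit] := pselect (exists A B : {set V}, [/\ A \subset W,
  B \subset W,
  [disjoint A & B], mindeg a A & mindeg b B]); exfalso.
pose degenerate_split A := [&& A \subset W, degenerate a.+1 A & degenerate b.+1
  (W :\: A)].
have [A0 A0deg] : exists A, degenerate_split A.
  pose P A := (A \subset W) && degenerate a.+1 A.
  have P0 : P set0.
    rewrite /P sub0set; apply/degenerateP=> B; rewrite subset0 => /eqP->.
    by rewrite /mindeg eqxx.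
  have [A /maxsetP[/andP[AW dA] maxA] _] := maxset_exists P0.
  exists A; rewrite /degenerate_split AW dA; apply:
    contraT => /ndegenerateP[B BWA gB].
  case/mindegP: (gB) => /set0Pn[x xB] _; have := subsetP BWA x xB; rewrite inE.
  case/andP=> xA xW; have : ~~ degenerate a.+1 (x |: A).
    apply/negP=> dxA; suff E : x |: A = A by move: xA; rewrite -E setU11.
    by apply: maxA; rewrite ?subsetUr // /P subUset sub1set xW AW.
  case/ndegenerateP=> C CA gC; case: nosplit; exists (C :\ x), B; split.
  - apply: subset_trans AW; rewrite subDset; exact: CA.
  - by apply: subset_trans BWA _; apply: subsetDl.
  - rewrite disjoint_sym; apply: disjointWl BWA _.
    rewrite -setI_eq0; apply/eqP/setP=> z; rewrite !inE.
    have [zC|] := boolP (z \in C); last by rewrite !andbF.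
    by have := subsetP CA z zC; rewrite !inE => /orP[]->; rewrite ?andbF.
  - exact: mindegD1.
  - exact: mindegW gB.
(* The weights make both moves of a vertex of low degree profitable. *)
pose w A := cut A (W :\: A) + a.+1 * #|A| + b.+1 * #|W :\: A|.
case: (arg_minnP w A0deg) => A /and3P[AW dA dB] minA.
set B := W :\: A in dB.
have BW : B \subset W by apply: subsetDl.
have WAB : W = A :|: B by rewrite /B -{1}(setIidPr AW) setID.
have disAB : [disjoint A & B] by rewrite disjoint_sym disjoints_subset; apply:
  subsetDr.
have A_B : W :\: B = A by rewrite /B setDDr setDv set0U; apply/setIidPr.
have degW x : x \in W -> a.+1 + b.+1 <= deg A x + deg B x.
  by move=> /dW; rewrite {1}WAB deg_setU.
have A_ne0 : A != set0.
  apply: contraTneq gW => A_0; apply/negP=> gW.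
  have WB : W = B by rewrite WAB A_0 set0U.
  move/degenerateP: dB => /(_ W); rewrite {1}WB subxx => /(_ isT)/negP[].
  by apply: mindegW gW; rewrite leq_addl.
have B_ne0 : B != set0.
  apply: contraTneq gW => B_0; apply/negP=> gW.
  have WA : W = A by rewrite WAB B_0 setU0.
  move/degenerateP: dA => /(_ W); rewrite {1}WA subxx => /(_ isT)/negP[].
  by apply: mindegW gW; rewrite leq_addr.
have [x xA xdeg] := degenerate_low_deg dA A_ne0.
have [y yB ydeg] := degenerate_low_deg dB B_ne0.
have xB : x \notin B by apply: contraL xA => xB; rewrite inE in xB; case/andP:
  xB.
have yA : y \notin A by move: yB; rewrite inE => /andP[].
have xW := subsetP AW x xA; have yW := subsetP BW y yB.
have WAx : W :\: (A :\ x) = x |: B.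
  by rewrite setDDr (setIidPr _) ?sub1set // setUC.
have WAy : W :\: (y |: A) = B :\ y by rewrite setUC setDDl.
have nx : ~~ degenerate b.+1 (x |: B).
  apply/negP=> dxB; have := minA (A :\ x); rewrite /degenerate_split WAx dxB.
  rewrite (degenerateS _ dA) ?subsetDl // (subset_trans (subsetDl _ _) AW).
  move=> /(_ isT); rewrite /w WAx -/B (cardsD1 x A) xA cardsU1 xB.
  exact: weight_arith (cut_move xA xB) (degW x xW) xdeg.
have ny : ~~ degenerate a.+1 (y |: A).
  apply/negP=> dyA; have := minA (y |: A); rewrite /degenerate_split WAy dyA.
  rewrite (degenerateS _ dB) ?subsetDl // subUset sub1set yW AW.
  move=> /(_ isT); rewrite /w WAy -/B (cardsD1 y B) yB cardsU1 yA.
  rewrite [cut A B]cutC [cut _ (B :\ y)]cutC addnAC [X in _ <= X]addnAC.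
  apply: weight_arith (cut_move yB yA) _ ydeg.
  by have := degW y yW; rewrite addnC [deg A y + _]addnC.
have [A' A'sub gA'] := ndegenerateP _ _ ny.
have [B' B'sub gB'] := ndegenerateP _ _ nx.
case: nosplit; exists (A' :\ x), (B' :\ y); split; try exact: mindegD1.
- apply: subset_trans (subsetDl _ _) (subset_trans A'sub _).
  by rewrite subUset sub1set yW AW.
- apply: subset_trans (subsetDl _ _) (subset_trans B'sub _).
  by rewrite subUset sub1set xW BW.
rewrite -setI_eq0; apply/eqP/setP=> z; rewrite !inE; apply/negP.
case/andP=> /andP[zx zA'] /andP[zy zB'].
have := subsetP A'sub z zA'; have := subsetP B'sub z zB'.
by rewrite !inE (negbTE zx) (negbTE zy) /= => /andP[/negP].
Qed.

(** Let [B] be a maximal connected set having a neighbour [x] outside.  All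
    neighbours of [x] are in [B]: otherwise [B] could be enlarged by [x]. *)
Lemma theta_of_mindeg r A : 0 < r -> mindeg r A ->
  exists B C : {set V}, [/\ B \subset A, C \subset A & theta_on r e B C].
Proof.
move=> r_gt0 /mindegP[/set0Pn[x0 x0A] dA].
pose P (B : {set V}) := (B \subset A) && `[< connected_in e B >] &&
  [exists x in A :\: B, exists y in B, e x y].
have [B0 PB0] : exists B, P B.
  have /card_gt0P[y] : 0 < deg A x0 by apply: leq_trans (dA x0 x0A).
  rewrite inE => /andP[yA xy]; exists [set y].
  rewrite /P sub1set yA; apply/andP; split.
    by apply/asboolP; apply: connected1.
  apply/exists_inP; exists x0.
    by rewrite !inE x0A andbT; apply: contraTneq xy => ->; rewrite irr_e.
  by apply/exists_inP; exists y; rewrite ?inE.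
have [B /maxsetP[/andP[/andP[BA /asboolP cB]]]] := maxset_exists PB0.
case/exists_inP=> x; rewrite inE => /andP[xB xA] /exists_inP[y yB exy] maxB _.
exists [set x], B; split=> //; first by rewrite sub1set.
split=> //; [exact: connected1 | by rewrite disjoints1 |].
apply: leq_trans (dA x xA) _.
have inj_x : injective (pair x : V -> _) by move=> ? ? [].
rewrite /deg -(card_imset _ inj_x).
apply: subset_leq_card; apply/subsetP=> _ /imsetP[z zN ->].
move: zN; rewrite inE => /andP[zA exz]; rewrite !inE eqxx exz andbT /=; apply:
  contraT => zB.
suff BE : x |: B = B by move: xB; rewrite -BE setU11.
apply: maxB; rewrite ?subsetUr // /P subUset sub1set xA BA /=; apply/andP;
  split.
  apply/asboolP; apply: (@connectedU _ _ _ _ x) => //; first exact: connected1.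
  by rewrite inE.
  by right; exists y.
apply/exists_inP; exists z.
  by rewrite !inE zA negb_or zB !andbT; apply: contraTneq exz => ->;
    rewrite irr_e.
by apply/exists_inP; exists x; rewrite ?setU11 // sym_e.
Qed.

Lemma packs_of_mindeg r k W : 0 < r -> mindeg (k * r.+2) W -> packs r e k W.
Proof.
move=> r_gt0; elim: k W => // k IHk W.
move=> gW; have {gW}: mindeg (r.+1 + (k * r.+2).+1) W by apply: mindegW gW;
  rewrite mulSn addnS addSn.
case/split_mindeg=> A [B [AW BW dAB /(theta_of_mindeg r_gt0)[X [Y [XA YA
  thXY]]]]].
move/IHk=> pB; exists X, Y; split=> //; try exact: subset_trans AW.
apply: packs_sub pB; rewrite subsetD BW disjoint_sym disjoints_subset subUset.
by rewrite -!disjoints_subset (disjointWl XA dAB) (disjointWl YA dAB).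
Qed.

End MinDegree.

(** * Partitions into parts of small radius *)

Section Cards.
Variables (I T : finType).

Lemma subset_of_card (A : {set T}) n : n <= #|A| ->
  exists2 B : {set T}, B \subset A & #|B| = n.
Proof.
case/card_geqP=> s [us ss sA]; exists [set x in s].
  by apply/subsetP=> x; rewrite inE => /sA.
by rewrite cardsE; move/card_uniqP: us => ->.
Qed.

Lemma card_bigcup_leq (X : {set I}) (F : I -> {set T}) n :
  (forall i, i \in X -> #|F i| <= n) -> #|\bigcup_(i in X) F i| <= #|X| * n.
Proof.
move=> leF; rewrite -sum_nat_const.
elim/big_ind2: _ => [|m1 A m2 B le1 le2|i iX]; rewrite ?cards0 ?leF //.
by apply: leq_trans (leq_add le1 le2); rewrite cardsU leq_subr.
Qed.

End Cards.

(** Each vertex [x] comes with a short connected set [path x] that links it to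
    the root [c x] of its part, so that any [n] vertices of a part lie in a
    connected subset of about [n * m] vertices. *)
Section Branches.
Variables (r m : nat) (V : finType) (e : rel V).
Variables (c : V -> V) (path : V -> {set V}).
Hypothesis pathE : forall x,
  [/\ x \in path x, c x \in path x, connected_in e (path x), #|path x| <= m.+1
    & forall y, y \in path x -> c y = c x].
Implicit Types X : {set V}.

Definition branches X := \bigcup_(x in X) path x.

Lemma sub_branches X : X \subset branches X.
Proof.
by apply/subsetP=> x xX; apply/bigcupP; exists x => //; case: (pathE x).
Qed.

Lemma connected_branches X v : (forall x, x \in X -> c x = v) ->
  connected_in e (branches X).
Proof.
move=> Xv; apply/connectedP=> P s /bigcupP[x0 x0X sx0] sP closP.
have pathP x t : x \in X -> t \in path x -> t \in P -> path x \subset P.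
  move=> xX tx tP; have [_ _ /connectedP cx _ _] := pathE x.
  apply: (cx _ t) => // a b ax bx; apply: closP; apply/bigcupP; by exists x.
have [_ vx0 _ _ _] := pathE x0; have vP := subsetP (pathP x0 s x0X sx0 sP) _
  vx0.
apply/bigcupsP=> x xX; apply: (pathP x (c x0)) => //.
by rewrite (Xv x0) // -(Xv x) //; case: (pathE x).
Qed.

Lemma branches_fib X v : (forall x, x \in X -> c x = v) ->
  forall y, y \in branches X -> c y = v.
Proof. by move=> Xv y /bigcupP[x xX] /(let: And5 _ _ _ _ h := pathE x in h)->;
  apply: Xv. Qed.

Lemma card_branches X v : (forall x, x \in X -> c x = v) ->
  #|branches X| <= (#|X| * m).+1.
Proof.
move=> Xv; rewrite (cardsD1 v) -add1n leq_add ?leq_b1 //.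
apply: leq_trans (card_bigcup_leq (F := fun x => path x :\ v) (n := m) _).
  apply: subset_leq_card; apply/subsetP=> y; rewrite inE => /andP[yv /bigcupP[x
    xX yx]].
  by apply/bigcupP; exists x => //; rewrite inE yv.
move=> x /Xv <-; have [_ cx _ le _] := pathE x.
by move: le; rewrite (cardsD1 (c x)) cx.
Qed.

Lemma connected_fib v : connected_in e (c @^-1: [set v]).
Proof.
have -> : c @^-1: [set v] = branches (c @^-1: [set v]).
  apply/eqP; rewrite eqEsubset sub_branches; apply/subsetP=> y yB;
    rewrite !inE; apply/eqP.
  by apply: branches_fib yB => x; rewrite !inE => /eqP.
by apply: (@connected_branches _ v) => x; rewrite !inE => /eqP.
Qed.

(** Only [r] of the edges between the two parts are kept, together with the
    branches of their ends. *)
Lemma theta_of_cross v w : v != w ->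
    r <= #|cross e (c @^-1: [set v]) (c @^-1: [set w])| ->
  exists A B, theta_on r e A B /\ #|A| + #|B| <= (r * m).+1.*2.
Proof.
move=> vw /subset_of_card[S /subsetP Ssub Sr].
have S1 x : x \in fst @: S -> c x = v.
  by case/imsetP=> p /Ssub; rewrite !inE => /and3P[/eqP ? _ _] ->.
have S2 x : x \in snd @: S -> c x = w.
  by case/imsetP=> p /Ssub; rewrite !inE => /and3P[_ /eqP ? _] ->.
exists (branches (fst @: S)), (branches (snd @: S)); split; last first.
  rewrite -addnn leq_add //.
    apply: leq_trans (card_branches S1) _.
    by rewrite ltnS leq_mul2r -Sr leq_imset_card orbT.
  apply: leq_trans (card_branches S2) _.
  by rewrite ltnS leq_mul2r -Sr leq_imset_card orbT.
split; [exact: connected_branches S1|exact: connected_branches S2| |].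
  rewrite -setI_eq0; apply/eqP/setP=> x; rewrite !inE; apply/negP=> /andP[].
  move=> /(branches_fib S1) xv /(branches_fib S2) xw.
  by move: vw; rewrite -xv xw eqxx.
rewrite -Sr; apply: subset_leq_card; apply/subsetP=> p pS.
have := Ssub p pS; rewrite !inE => /and3P[_ _ ->]; rewrite andbT.
by apply/andP; split; apply: (subsetP (sub_branches _)); apply: imset_f.
Qed.

Lemma theta_of_star X x v : (forall y, y \in X -> c y = v /\ x \notin path y) ->
    (forall y, y \in X -> e x y) -> r <= #|X| ->
  exists A B, theta_on r e A B /\ #|A| + #|B| <= (r * m).+2.
Proof.
move=> Xv eX /subset_of_card[Y /subsetP YX Yr].
have Yv y : y \in Y -> c y = v by move=> /YX/Xv[].
exists [set x], (branches Y); split; last first.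
  by rewrite cards1 add1n ltnS -Yr; apply: card_branches Yv.
split; [exact: connected1|exact: connected_branches Yv| |].
  by rewrite disjoints1; apply/bigcupP=> -[y /YX/Xv[_ /negP]].
have inj_x : injective (pair x : V -> _) by move=> ? ? [].
rewrite -Yr -(card_imset Y inj_x).
apply: subset_leq_card; apply/subsetP=> _ /imsetP[y yY ->].
by rewrite !inE eqxx (subsetP (sub_branches Y)) //= eX ?YX.
Qed.

End Branches.

(** * Sparse graphs without small theta graphs *)

Section Forest.
Variables (V : finType) (e : rel V).
Hypothesis sym_e : symmetric e.

Fixpoint within n x y : bool :=
  if n is n'.+1 then within n' x y || [exists z, within n' x z && e z y]
  else x == y.

Lemma within_leq m n x y : m <= n -> within m x y -> within n x y.
Proof.
by elim: n => [|n IHn]; rewrite leq_eqVlt => /orP[/eqP->//|//];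
  rewrite ltnS /= => /IHn h /h->.
Qed.

Lemma withinS n x y z : within n x y -> e y z -> within n.+1 x z.
Proof. by move=> xy yz /=; apply/orP; right; apply/existsP; exists y;
  rewrite xy. Qed.

Lemma within_join m n x y z : within m x y -> within n z y -> within (m + n) x
  z.
Proof.
elim: n m y => [|n IHn] m y xy /=; first by move/eqP->; rewrite addn0.
rewrite addnS; case/orP=> [zy|/existsP[y' /andP[zy' ey'y]]].
  by rewrite /= (IHn m y).
by rewrite -addSn; apply: IHn zy'; apply: withinS xy _; rewrite sym_e.
Qed.

(** Take a maximal set of centres at pairwise distance more than [2 * d] and
    assign to each vertex a closest centre [rho x], along breadth-first search
    trees with parent function [par].  Maximality bounds the depth, and the
    distance between centres keeps the ball of radius [d] around a centre
    inside its part. *)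
Lemma bfs_forest d : exists (lev : V -> nat) (par rho : V -> V),
  [/\ forall x, lev x = 0 -> rho x = x,
      forall x n, lev x = n.+1 -> [/\ e x (par x),
        lev (par x) = n & rho (par x) = rho x],
      forall x y, e x y -> lev y <= (lev x).+1,
      forall x, lev x <= d.*2
    & forall x y, lev x < d -> e x y -> rho y = rho x].
Proof.
pose P (C : {set V}) := [forall x in C, forall y in C,
  (x != y) ==> ~~ within d.*2 x y].
have P0 : P set0 by apply/forall_inP=> x; rewrite inE.
have [C /maxsetP[/forall_inP sepC maxC] _] := maxset_exists P0.
have {}sepC x y : x \in C -> y \in C -> within d.*2 x y -> x = y.
  move=> xC yC xy; apply/eqP; apply: contraLR xy => nxy.
  by have /forall_inP/(_ y yC)/implyP := sepC x xC; apply.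
have sym_within n x y : within n x y -> within n y x.
  by move=> xy; rewrite -[n]add0n; apply: within_join xy => /=.
pose near n x := [exists v in C, within n v x].
have near_all x : near d.*2 x.
  apply: contraT => /exists_inPn farx.
  suff E : x |: C = C.
    by have := farx x; rewrite -E setU11 (within_leq (leq0n _)) /= => [/(_
      isT)|].
  apply: maxC; rewrite ?subsetUr //; apply/forall_inP=> y yC.
  apply/forall_inP=> z zC; apply/implyP; apply: contra_neqN => yz.
  case/setU1P: yC yz => [->|yC]; case/setU1P: zC => [->|zC] // yz.
  - by have := farx z zC; rewrite sym_within.
  - by have := farx y yC; rewrite yz.
  - exact: sepC.
have near_ex x : exists n, near n x by exists d.*2.
pose lev x := ex_minn (near_ex x).
have near_lev x : near (lev x) x by rewrite /lev; case: ex_minnP.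
have lev_min x n : near n x -> lev x <= n.
  by rewrite /lev; case: ex_minnP => m _ le /le.
have nearS n x y : near n x -> e x y -> near n.+1 y.
  by move=> /exists_inP[v vC vx] xy; apply/exists_inP; exists v;
    rewrite ?(withinS vx).
pose par x := odflt x [pick z | near (lev x).-1 z && e z x].
have parP x n : lev x = n.+1 -> e x (par x) /\ lev (par x) = n.
  move=> xn; rewrite /par; case: pickP => [z /andP[/= nz ezx]|none] /=.
    rewrite sym_e; split=> //; apply/eqP; rewrite eqn_leq.
    move: nz; rewrite xn /= => /lev_min ->.
    by rewrite -ltnS -xn; apply: lev_min; apply: nearS ezx.
  have := near_lev x; rewrite xn => /exists_inP[v vC /=].
  case/orP=> [vx|/existsP[z /andP[vz ezx]]].
    suff : lev x <= n by rewrite xn ltnn.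
    by apply: lev_min; apply/exists_inP; exists v.
  by have := none z; rewrite xn ezx /= andbT => /exists_inPn/(_ v vC)/negP.
pose rho x := iter (lev x) par x.
have rhoP x n : lev x = n -> rho x \in C /\ within n (rho x) x.
  rewrite /rho; elim: n x => [|n IHn] x xn; rewrite xn.
    have := near_lev x; rewrite xn => /exists_inP[v vC /= /eqP <-].
    by rewrite vC eqxx.
  rewrite iterSr; have [ex px] := parP x n xn.
  have [pC pW] := IHn _ px; rewrite px in pC pW.
  by split=> //; apply: withinS pW _; rewrite sym_e.
exists lev, par, rho; split.
- by move=> x x0; rewrite /rho x0.
- move=> x n xn; have [ex px] := parP x n xn; split=> //.
  by rewrite /rho px xn iterSr.
- by move=> x y xy; apply: lev_min; apply: nearS xy.
- by move=> x; apply: lev_min.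
- move=> x y xd xy; have [xC xW] := rhoP x _ erefl;
  have [yC yW] := rhoP y _ erefl.
  apply/esym/sepC => //; apply: within_leq (within_join (withinS xW xy) yW).
  rewrite -addnn leq_add // (leq_trans _ xd) //.
  by apply: lev_min; apply: nearS xy.
Qed.

End Forest.

Section RootPath.
Variables (V : finType) (e : rel V) (lev : V -> nat) (par rho : V -> V).
Hypotheses (sym_e : symmetric e)
  (rho0 : forall x, lev x = 0 -> rho x = x)
  (parP : forall x n, lev x = n.+1 ->
     [/\ e x (par x), lev (par x) = n & rho (par x) = rho x]).

Fixpoint root_path_rec n x : {set V} :=
  if n is n'.+1 then x |: root_path_rec n' (par x) else [set x].

Definition root_path x := root_path_rec (lev x) x.

Lemma root_pathS x n : lev x = n.+1 -> root_path x = x |: root_path (par x).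
Proof. by move=> xn; have [_ pn _] := parP xn; rewrite /root_path xn pn. Qed.

Lemma root_path0 x : lev x = 0 -> root_path x = [set x].
Proof. by rewrite /root_path => ->. Qed.

Lemma root_path_self x : x \in root_path x.
Proof.
case E: (lev x) => [|n]; first by rewrite root_path0 ?inE.
by rewrite (root_pathS E) setU11.
Qed.

Lemma root_path_ind (P : V -> Prop) :
  (forall x, lev x = 0 -> P x) ->
  (forall x, 0 < lev x -> P (par x) -> P x) -> forall x, P x.
Proof.
move=> P0 PS x; move E: (lev x) => n; elim: n x E => [|n IHn] x xn.
  exact: P0.
by apply: PS; rewrite ?xn //; apply: IHn; have [] := parP xn.
Qed.

Lemma root_path_lev x y : y \in root_path x -> y = x \/ lev y < lev x.
Proof.
elim/root_path_ind: x => x x0; first by rewrite root_path0 // => /set1P; left.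
move=> IH; case E: (lev x) x0 => [//|n] _; rewrite (root_pathS E).
case/setU1P => [|/IH h]; [by left|right].
by have [_ pn _] := parP E; case: h => [->|]; rewrite ?pn // => /leqW.
Qed.

Lemma root_path_same_lev x y z :
  y \in root_path x -> z \in root_path x -> lev y = lev z -> y = z.
Proof.
elim/root_path_ind: x => x x0.
  by rewrite root_path0 // => /set1P-> /set1P->.
move=> IH; case E: (lev x) x0 => [//|n] _; rewrite (root_pathS E).
have [_ pn _] := parP E.
have lt t : t \in root_path (par x) -> lev t < lev x.
  by case/root_path_lev => [->|]; rewrite E pn // => /leqW.
case/setU1P => [->|yp]; case/setU1P => [->|zp] //; last exact: IH.
  by move=> xz; have := lt z zp; rewrite -xz ltnn.
by move=> yx; have := lt y yp; rewrite yx ltnn.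
Qed.

Lemma root_path_sub x y : y \in root_path x -> root_path y \subset root_path x.
Proof.
elim/root_path_ind: x => x x0; first by rewrite root_path0 // => /set1P->;
  rewrite root_path0.
move=> IH; case E: (lev x) x0 => [//|n] _.
rewrite {1}(root_pathS E) => /setU1P[->//|/IH sub].
by rewrite (root_pathS E); apply: subset_trans sub (subsetUr _ _).
Qed.

Lemma root_pathP m : (forall x, lev x <= m) -> forall x,
  [/\ x \in root_path x, rho x \in root_path x, connected_in e (root_path x),
      #|root_path x| <= m.+1
    & forall y, y \in root_path x -> rho y = rho x].
Proof.
move=> lem x; suff [h1 h2 h3 h4] : [/\ rho x \in root_path x,
  connected_in e (root_path x),
      #|root_path x| <= (lev x).+1
    & forall y, y \in root_path x -> rho y = rho x].
  by split=> //; [exact: root_path_self | apply: leq_trans h3 _; rewrite ltnS].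
elim/root_path_ind: x => x x0.
  rewrite root_path0 // rho0 // cards1 !inE eqxx; split=> //; first exact:
    connected1.
  by move=> y /set1P->; exact: rho0.
case E: (lev x) x0 => [//|n] _ [h1 h2 h3 h4].
have [exp pn pr] := parP E.
rewrite (root_pathS E) -pr; split.
- by rewrite inE h1 orbT.
- apply: (connectedU (x := x)) => //; [exact: connected1|by rewrite inE|right].
  by exists (par x) => //; apply: root_path_self.
- by rewrite cardsU1 -add1n leq_add ?leq_b1 // -pn.
- by move=> y /setU1P[->|/h4].
Qed.

End RootPath.

Section Sparse.
Variables (q d k : nat) (V : finType) (e : rel V).
Hypotheses (q_gt0 : 0 < q) (sym_e : symmetric e) (irr_e : irreflexive e).
Hypothesis min_deg : forall x y, e x y -> 3 * q <= deg e [set: V] x.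
Hypothesis has_edge : exists x y, e x y.
Hypothesis dk : q * (k * q.+3) <= 2 ^ d.
Hypothesis no_small : forall A B,
  theta_on q.+1 e A B -> #|A| + #|B| <= (q.+1 * d.*2).+1.*2 -> False.

(** The number of vertices of level [i] in a part at least doubles up to level
    [d]; hence the part has [2 ^ d] leaves, each with an edge leaving the part,
    and the graph of parts has minimum degree at least [k * q.+3]. *)
Lemma packs_of_no_small_theta : packs q.+1 e k [set: V].
Proof.
have [lev [par [rho [rho0 parP levS levd same]]]] := bfs_forest sym_e d.
pose path := root_path lev par.
have pathE := root_pathP sym_e rho0 parP levd.
have path_lev := root_path_lev parP.
pose fib v : {set V} := rho @^-1: [set v].
(* Otherwise [x] and the branches of [X] form a small theta. *)
have few x (X : {set V}) : (forall y, y \in X -> [/\ e x y,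
  rho y = rho x & x \notin path y]) ->
    #|X| <= q.
  move=> Xx; rewrite -ltnS ltnNge; apply/negP=> leX.
  have [y /Xx[]//|y /Xx[]//|A [B [thAB leAB]]] := theta_of_star pathE (x := x)
    (v := rho x) _ _ leX.
  by apply: (no_small thAB); apply: leq_trans leAB _; move: (q.+1 * _) => z;
    rewrite doubleS !ltnS -addnn leq_addr.
pose noniso x := [exists y, e x y].
have deg_noniso x : noniso x -> 3 * q <= deg e [set: V] x.
  by case/existsP=> y; apply: min_deg.
have noniso_rho x : noniso (rho x) = noniso x.
  elim/(root_path_ind parP): x => x x0; first by rewrite rho0.
  case E: (lev x) x0 => [//|n] _; have [exp pn pr] := parP _ _ E.
  rewrite pr => ->; apply/existsP/existsP => _; first by exists (par x).
  by exists x; rewrite sym_e.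
have rho_idem x : rho (rho x) = rho x.
  by have [_ rp _ _ h] := pathE x; apply: h.
have lev_rho x : lev (rho x) = 0.
  elim/(root_path_ind parP): x => x x0; first by rewrite rho0.
  by case E: (lev x) x0 => [//|n] _; have [_ _ ->] := parP _ _ E.
pose L v i := [set x | (rho x == v) && (lev x == i)].
have few_low x : #|[set y | [&& e x y, rho y == rho x & lev y <= lev x]]| <= q.
  apply: (few x) => y; rewrite inE => /and3P[xy /eqP ryx yx]; split=> //.
  apply/negP=> /path_lev[E|]; first by move: xy; rewrite E irr_e.
  by rewrite ltnNge yx.
(* Count the edges between consecutive levels from both sides. *)
have growth v i : noniso v -> i < d -> 2 * #|L v i| <= #|L v i.+1|.
  move=> nv id.
  have up x : x \in L v i -> 2 * q <= deg e (L v i.+1) x.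
    rewrite inE => /andP[/eqP xv /eqP xi].
    have := deg_noniso x; rewrite -noniso_rho xv => /(_ nv).
    have -> : 3 * q = q + 2 * q by rewrite mulSn.
    have le : deg e [set: V] x <= q + deg e (L v i.+1) x.
      apply: leq_trans (leq_add (few_low x) (leqnn _)).
      apply: leq_trans (leq_card_setU _ _).
      apply: subset_leq_card; apply/subsetP=> y; rewrite !inE /= => xy.
      have yx : rho y = rho x by apply: same xy; rewrite xi.
      rewrite xy yx xv eqxx xi /= andbT.
      by have := levS x y xy; rewrite xi leq_eqVlt ltnS orbC.
    by move=> /leq_trans/(_ le); rewrite leq_add2l.
  have down y : y \in L v i.+1 -> deg e (L v i) y <= q.
    rewrite inE => /andP[/eqP yv /eqP yi]; apply: leq_trans (few_low y).
    apply: subset_leq_card; apply/subsetP=> x; rewrite !inE.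
    by case/andP=> /andP[/eqP-> /eqP->] ->; rewrite yv yi eqxx /=.
  rewrite -(leq_pmul2l q_gt0).
  have le1 : #|L v i| * (2 * q) <= cut e (L v i) (L v i.+1).
    by rewrite -sum_nat_const; apply: leq_sum.
  have le2 : cut e (L v i.+1) (L v i) <= #|L v i.+1| * q.
    by rewrite -sum_nat_const; apply: leq_sum.
  rewrite cutC // in le2; have := leq_trans le1 le2; lia.
have levels v i : noniso v -> rho v = v -> i <= d -> 2 ^ i <= #|L v i|.
  move=> nv vv; elim: i => [|i IHi] id.
    by apply/card_gt0P; exists v; rewrite inE vv -vv lev_rho !eqxx.
  rewrite expnS; apply: leq_trans (growth v i nv id).
  by rewrite leq_mul2l /= IHi // ltnW.
(* Below each vertex of level [d] hangs a leaf, and all but [q] of its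
     neighbours lie in other parts. *)
pose out v := [set p | [&& rho p.1 == v, rho p.2 != v & e p.1 p.2]].
have out_big v : noniso v -> rho v = v -> 2 ^ d <= #|out v|.
  move=> nv vv; apply: leq_trans (levels v d nv vv (leqnn d)) _.
  have leaf x : x \in L v d -> exists2 p, p \in out v & x \in path p.1.
    rewrite inE => /andP[/eqP xv /eqP xd].
    have xx : x \in path x by have [] := pathE x.
    case: (@arg_maxnP _ x (fun u => x \in path u) lev xx) => u xu maxu.
    have ruv : rho u = v.
      by rewrite -xv; have [_ _ _ _ h] := pathE u; rewrite (h x).
    have : #|[set y | e u y && (rho y == rho u)]| <= q.
      apply: (few u) => y; rewrite inE => /andP[uy /eqP yu]; split=> //.
      apply/negP=> u_y; have /subsetP/(_ x xu) xy := root_path_sub parP u_y.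
      case: (path_lev _ _ u_y) => [E|]; first by move: uy; rewrite E irr_e.
      by move=> /leq_trans/(_ (maxu y xy)); rewrite ltnn.
    move=> leq_in.
    have : ~~ ([set y | e u y] \subset [set y | e u y && (rho y == rho u)]).
      apply/negP=> /subset_leq_card le; have := deg_noniso u.
      rewrite -noniso_rho ruv /deg => /(_ nv).
      have -> : [set y in [set: V] | e u y] = [set y | e u y].
        by apply/setP=> y; rewrite !inE.
      move=> /leq_trans/(_ (leq_trans le leq_in)).
      by rewrite -{2}[q]mul1n leq_pmul2r.
    case/subsetPn=> y; rewrite !inE => uy; rewrite uy ruv /= => yv.
    by exists (u, y); rewrite ?inE //= ruv eqxx yv.
  pose f x := odflt (x, x) [pick p in out v | x \in path p.1].
  have fP x : x \in L v d -> f x \in out v /\ x \in path (f x).1.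
    move=> /leaf[p pout xp]; rewrite /f; case: pickP => [p' /andP[] //|none].
    by have := none p; rewrite pout xp.
  rewrite -(card_in_imset (f := f)).
    by apply: subset_leq_card; apply/subsetP=> _ /imsetP[x /fP[? _] ->].
  move=> x y xL yL fxy; have [_ xp] := fP x xL; have [_ yp] := fP y yL.
  apply: (root_path_same_lev parP xp); first by rewrite fxy.
  by move: xL yL; rewrite !inE => /andP[_ /eqP->] /andP[_ /eqP->].
pose E := qrel e rho.
have thin v w : v != w -> #|cross e (fib v) (fib w)| <= q.
  move=> vw; rewrite -ltnS ltnNge; apply/negP=> le.
  have [A [B [thAB leAB]]] := theta_of_cross pathE vw le.
  exact: no_small thAB leAB.
pose W := [set v | noniso v && (rho v == v)].
apply: (packs_sub (W := rho @^-1: W)); first exact: subsetT.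
apply: (packs_preim (connected_fib pathE)); apply: packs_of_mindeg => //.
- exact: qrel_sym.
- exact: qrel_irr.
apply/mindegP; split.
  have [x [y xy]] := has_edge; apply/set0Pn; exists (rho x).
  by rewrite inE noniso_rho rho_idem eqxx andbT; apply/existsP; exists y.
move=> v; rewrite inE => /andP[nv /eqP vv].
rewrite -(leq_pmul2l q_gt0) (leq_trans dk) // (leq_trans (out_big v nv vv)) //.
rewrite mulnC.
apply: leq_trans (card_bigcup_leq (F := fun w => cross e (fib v) (fib w)) _).
  apply: subset_leq_card; apply/subsetP=> -[x y];
    rewrite inE /= => /and3P[xv yv xy].
  apply/bigcupP; exists (rho y); last by rewrite !inE xv eqxx.
  rewrite !inE noniso_rho rho_idem eqxx andbT; apply/andP; split.
    by apply/existsP; exists x; rewrite sym_e.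
  by apply/qrelP; split; [rewrite eq_sym | exists x, y; rewrite (eqP xv)].
move=> w; rewrite !inE => /andP[_ /qrelP[vw _]]; exact: thin.
Qed.

End Sparse.

(** * Suppression of vertices of low degree *)

Section Lift.
Variables (r : nat) (V : finType) (e : rel V) (phi : V -> V).
Hypotheses (sym_e : symmetric e) (phi_idem : forall x, phi (phi x) = phi x)
  (star : forall x, phi x = x \/ e x (phi x)).

(** Each new vertex of [A] costs at most three vertices: itself and the ends of
    the edge that links its star to the part already lifted. *)
Lemma lift_connected (A : {set V}) v : connected_in (qrel e phi) A ->
    v \in A -> phi v = v ->
  exists B : {set V}, [/\ connected_in e B, A \subset B,
    forall x, x \in B -> phi x \in A & #|B| <= 3 * #|A|].
Proof.
move=> /connectedP cA vA vv.
pose lifts (C B : {set V}) := [/\ connected_in e B, C \subset B,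
  forall x, x \in B -> phi x \in A & #|B| <= 3 * #|C|].
pose P (C : {set V}) := [&& C \subset A, v \in C & `[< exists B, lifts C B >]].
have Pv : P [set v].
  rewrite /P sub1set vA set11; apply/asboolP; exists [set v].
  split=> //; [exact: connected1| by move=> x /set1P->;
    rewrite vv | by rewrite cards1].
have [C /maxsetP[/and3P[CA vC /asboolP[B [cB CB BA leB]]] maxC] _] :=
  maxset_exists Pv.
suff sAC : A \subset C.
  have E : A = C by apply/eqP; rewrite eqEsubset sAC.
  by exists B; split=> //; rewrite E.
apply: (cA C v) => // x y xA yA xC /qrelP[xy [x' [y' [x'x y'y exy]]]].
apply: contraT => yC; suff E : y |: C = C by move: yC; rewrite -E setU11.
apply: maxC; rewrite ?subsetUr // /P subUset sub1set yA CA inE vC orbT /=.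
apply/asboolP; exists (B :|: [set x'] :|: [set y'] :|: [set y]).
have xB : x \in B by apply: (subsetP CB).
split.
- apply: connected_extend => //; first apply: connected_extend => //;
  first apply: connected_extend => //.
  + move=> _ /set1P->; case: (star x') => [E|ex]; first by left; rewrite -E x'x.
    by right; exists x => //; rewrite sym_e -x'x.
  + by move=> _ /set1P->; right; exists x' => //; rewrite !inE eqxx orbT.
  + move=> _ /set1P->; case: (star y') => [E|ey].
      by left; rewrite -y'y E !inE eqxx !orbT.
    by right; exists y'; [rewrite !inE eqxx orbT|rewrite -y'y].
- by rewrite subUset sub1set !inE eqxx orbT /=;
  apply/subsetP=> z /(subsetP CB); rewrite !inE => ->.
- move=> z; rewrite !inE -!orbA => /or4P[/BA //|/eqP->|/eqP->|/eqP->];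
  rewrite ?x'x ?y'y //.
  by rewrite -y'y phi_idem y'y.
rewrite cardsU1 yC mulnDr muln1 [3 + _]addnC.
have cU (X : {set V}) z : #|X :|: [set z]| <= #|X| + 1.
  by apply: leq_trans (leq_card_setU _ _) _; rewrite cards1.
do 3! (apply: leq_trans (cU _ _) _; rewrite ?addnS ?addn0 ?ltnS).
exact: leB.
Qed.

Lemma lift_theta (A B : {set V}) : 0 < r -> theta_on r (qrel e phi) A B ->
  exists A' B', theta_on r e A' B' /\ #|A'| + #|B'| <= 3 * (#|A| + #|B|) + 2 *
    r.
Proof.
move=> r_gt0 [cA cB dAB leAB].
have fixed v w : qrel e phi v w -> phi v = v /\ phi w = w.
  by case/qrelP=> _ [x [y [<- <- _]]].
have [p0 p0AB] : exists p, p \in cross (qrel e phi) A B.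
  by apply/card_gt0P; apply: leq_trans leAB.
move: (p0AB); rewrite inE => /and3P[vA wB /fixed[vv ww]].
have [A1 [cA1 AA1 A1A leA1]] := lift_connected cA vA vv.
have [B1 [cB1 BB1 B1B leB1]] := lift_connected cB wB ww.
have [S /subsetP Ssub Sr] := subset_of_card leAB.
pose f p := odflt p [pick p' | [&& phi p'.1 == p.1,
  phi p'.2 == p.2 & e p'.1 p'.2]].
have fP p : p \in S -> [/\ phi (f p).1 = p.1, phi (f p).2 = p.2,
  e (f p).1 (f p).2, p.1 \in A & p.2 \in B].
  move=> /Ssub; rewrite inE => /and3P[pA pB /qrelP[_ [x [y [xp yp exy]]]]].
  rewrite /f; case: pickP => [p' /and3P[/eqP ? /eqP ? ?] //|/(_ (x, y))].
  by rewrite /= xp yp exy !eqxx.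
have link v x (A0 : {set V}) : v \in A0 -> phi x = v -> x \in A0 \/ exists2 y,
  y \in A0 & e y x.
  move=> vA0 xv; case: (star x) => [E|ex]; first by left; rewrite -E xv.
  by right; exists v => //; rewrite -xv sym_e.
pose A2 := [set (f p).1 | p in S]; pose B2 := [set (f p).2 | p in S].
have A2A x : x \in A1 :|: A2 -> phi x \in A.
  by case/setUP=> [/A1A//|/imsetP[p /fP[p1 _ _ pA _] ->]]; rewrite p1.
have B2B x : x \in B1 :|: B2 -> phi x \in B.
  by case/setUP=> [/B1B//|/imsetP[p /fP[_ p2 _ _ pB] ->]]; rewrite p2.
exists (A1 :|: A2), (B1 :|: B2); split; last first.
  have /leq_trans h1 := leq_card_setU A1 A2; have /leq_trans h2 :=
    leq_card_setU B1 B2.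
  have a2 : #|A2| <= r by rewrite -Sr leq_imset_card.
  have b2 : #|B2| <= r by rewrite -Sr leq_imset_card.
  have -> : 3 * (#|A| + #|B|) + 2 * r = (3 * #|A| + r) + (3 * #|B| + r) by
    rewrite mulnDr mul2n -addnn addnACA.
  by rewrite leq_add ?h1 ?h2 ?leq_add.
split.
- apply: connected_extend => // x /imsetP[p /fP[p1 _ _ pA _] ->].
  exact: link (subsetP AA1 _ pA) p1.
- apply: connected_extend => // x /imsetP[p /fP[_ p2 _ _ pB] ->].
  exact: link (subsetP BB1 _ pB) p2.
- rewrite -setI_eq0; apply/eqP/setP=> x; rewrite [RHS]inE;
  apply/negP=> /setIP[/A2A xA /B2B xB].
  by move/pred0P: dAB => /(_ (phi x)) /=; rewrite xA xB.
rewrite -Sr -(card_in_imset (f := f)) => [|p p' pS p'S ff].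
  apply: subset_leq_card; apply/subsetP=> _ /imsetP[p pS ->].
  have [_ _ ep _ _] := fP p pS.
  rewrite inE ep andbT; apply/andP.
  by split; apply/setUP; right; apply/imsetP; exists p.
have [p1 p2 _ _ _] := fP p pS; have [p'1 p'2 _ _ _] := fP p' p'S.
by rewrite [p]surjective_pairing [p']surjective_pairing -p1 -p2 -p'1 -p'2 ff.
Qed.

End Lift.

Section Suppress.
Variables (q d k : nat) (V : finType) (e : rel V).
Hypotheses (q_gt0 : 0 < q) (sym_e : symmetric e) (irr_e : irreflexive e).
Hypothesis edge_deg : forall x y, e x y ->
  6 * q ^ 2 <= deg e [set: V] x + deg e [set: V] y.
Hypothesis no_leaf : forall x y, e x y -> exists2 z, z != y & e x z.
Hypothesis has_edge : exists x y, e x y.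
Hypothesis dk : q * (k * q.+3) <= 2 ^ d.
Hypothesis no_small : forall A B, theta_on q.+1 e A B ->
  #|A| + #|B| <= 3 * (q.+1 * d.*2).+1.*2 + 2 * q.+1 -> False.

(** Vertices of degree less than [3 * q ^ 2] are pairwise non-adjacent; send
    each to a neighbour of high degree.  A vertex [v] of high degree keeps
    [3 * q ^ 2] edges leaving its star: a neighbour absorbed by [v] has, by
    [no_leaf], another neighbour, which lies in another star. *)
Lemma packs_of_heavy_edges : packs q.+1 e k [set: V].
Proof.
pose high x := 3 * q ^ 2 <= deg e [set: V] x.
have low_nbr x y : e x y -> ~~ high x -> high y.
  move=> /edge_deg; rewrite /high -ltnNge => sum_deg x_low.
  rewrite -(leq_add2l (deg e [set: V] x)); apply: leq_trans sum_deg.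
  by rewrite -[6]/(3 + 3) mulnDl leq_add2r ltnW.
pose phi x := if high x then x else odflt x [pick y | e x y].
have phi_high x : high x -> phi x = x by rewrite /phi => ->.
have star x : phi x = x \/ e x (phi x).
  by rewrite /phi; case: ifP => _; [left|case: pickP => [y|]; [right|left]].
have high_phi x y : e x y -> high (phi x).
  move=> xy; rewrite /phi; case: ifPn => // xlow.
  by case: pickP => [z /= /low_nbr|/(_ y)]; [apply|rewrite xy].
have phi_idem x : phi (phi x) = phi x.
  case: (star x) => [E|/high_phi/phi_high]; first by rewrite !E.
  by [].
have pathE x : [/\ x \in [set x; phi x], phi x \in [set x; phi x],
    connected_in e [set x; phi x], #|[set x; phi x]| <= 2
    & forall y, y \in [set x; phi x] -> phi y = phi x].
  rewrite !inE !eqxx orbT cards2 ltnS leq_b1; split=> //;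
    last by move=> y /set2P[]->.
  apply: connected_extend => //; first exact: connected1.
  move=> _ /set1P->; rewrite !inE; case: (star x) => [->|]; first by left.
  by right; exists x; rewrite ?inE.
pose fib v : {set V} := phi @^-1: [set v].
have thin v w : v != w -> #|cross e (fib v) (fib w)| <= q.
  move=> vw; rewrite -ltnS ltnNge; apply/negP=> le.
  have [A [B [thAB leAB]]] := theta_of_cross pathE vw le.
  apply: (no_small thAB); apply: leq_trans leAB _.
  rewrite muln1; lia.
pose out v := [set p | [&& phi p.1 == v, phi p.2 != v & e p.1 p.2]].
have out_qrel v p : p \in out v -> qrel e phi v (phi p.2).
  rewrite inE => /and3P[/eqP pv pv' ep]; apply/qrelP; rewrite eq_sym.
  by split=> //; exists p.1, p.2.
pose f v u := if phi u != v then (v, u)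
  else (u, odflt u [pick u' | (u' != v) && e u u']).
have fP v u : high v -> e v u -> f v u \in out v.
  move=> /phi_high vv evu; rewrite /f.
  case: ifPn => [uv|]; first by rewrite inE /= vv eqxx uv.
  rewrite negbK => uv; have euv : e u v by rewrite sym_e.
  have u_low : ~~ high u.
    apply: contraTN evu => /phi_high uu; move: uv; rewrite uu => /eqP->.
    by rewrite irr_e.
  case: pickP => [u' /andP[u'v uu'] /=|none].
    by rewrite inE /= uv uu' phi_high ?u'v // (low_nbr u).
  by have [z zv uz] := no_leaf euv; have := none z; rewrite zv uz.
apply: (packs_sub (W := phi @^-1: [set: V])); first exact: subsetT.
apply: (packs_preim (connected_fib pathE)).
apply: (packs_of_no_small_theta (d := d)) => //.
- exact: qrel_sym.
- exact: qrel_irr.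
- move=> v w /qrelP[_ [x [y [xv _ exy]]]].
  have v_high : high v by rewrite -xv; apply: high_phi exy.
  rewrite -(leq_pmul2l q_gt0) mulnCA -[q * q]/(q ^ 2) (leq_trans v_high) //.
  have injf : {in [set u in [set: V] | e v u] &, injective (f v)}.
    move=> u u'; rewrite !inE /= => vu vu'; rewrite /f.
    case: ifP => _; case: ifP => _ [] //; first by move=> E; move: vu';
      rewrite -E irr_e.
    by move=> E; move: vu; rewrite E irr_e.
  rewrite /deg -(card_in_imset injf) mulnC.
  apply: leq_trans (card_bigcup_leq (F := fun w => cross e (fib v) (fib w)) _).
    apply: subset_leq_card; apply/subsetP=> _ /imsetP[u uN ->].
    move: uN; rewrite inE => /andP[_ /(fP v u v_high) fu].
    apply/bigcupP; exists (phi (f v u).2); first by rewrite !inE out_qrel.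
    by move: fu; rewrite !inE => /and3P[-> _ ->]; rewrite eqxx.
  by move=> z; rewrite inE => /andP[_ /qrelP[vz _]]; apply: thin.
- have [x [y /high_phi xhigh]] := has_edge.
  have /card_gt0P[u] : 0 < deg e [set: V] (phi x).
    by apply: leq_trans xhigh; rewrite muln_gt0 expn_gt0 q_gt0.
  rewrite !inE /= => xu; exists (phi x), (phi (f (phi x) u).2).
  exact/out_qrel/fP.
- move=> A B thAB leAB; have [A' [B' [thAB' leAB']]] := lift_theta sym_e
  phi_idem star (ltn0Sn q) thAB.
  by apply: (no_small thAB'); apply: leq_trans leAB' _;
    rewrite leq_add2r leq_mul2l leAB orbT.
Qed.

End Suppress.

(** * Rooted tree-decompositions *)

Section RootedDecomposition.
Variable V : finType.
Implicit Types (e : rel V) (Y R Z W : {set V}).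

(** A tree-decomposition of the subgraph induced by [Y] with bags of at most
    [n] vertices and [R] contained in the root bag.  Connectivity of the set of
    bags containing a vertex [v] is expressed by the existence of a topmost
    one: every other bag containing [v] has a parent containing [v]. *)
Definition rooted_dec e n Y R : Prop :=
  exists (T : finType) (root : T) (par : T -> T) (rank : T -> nat)
    (bag : T -> {set V}),
  [/\ par root = root /\ forall t, t != root -> rank (par t) < rank t,
      R \subset bag root,
      forall t, #|bag t| <= n /\ bag t \subset Y,
      forall v, v \in Y -> exists2 top, v \in bag top
        & forall t, v \in bag t -> t != top -> t != root /\ v \in bag (par t)
    & forall x y, x \in Y -> y \in Y -> e x y ->
        exists2 t, x \in bag t & y \in bag t].

Lemma rooted_dec_bag e n R : #|R| <= n -> rooted_dec e n R R.
Proof.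
move=> leR; exists unit, tt, id, (fun=> 0), (fun=> R); split=> //.
- by move=> v vR; exists tt => // t _; case: t.
Qed.

Lemma rooted_decW e n m Y R R' : n <= m -> R' \subset R ->
  rooted_dec e n Y R -> rooted_dec e m Y R'.
Proof.
move=> nm R'R [T [root [par [rank [bag [par_rank Rroot bagn tops edges]]]]]].
exists T, root, par, rank, bag; split=> //; first exact: subset_trans Rroot.
by move=> t; have [le sub] := bagn t; rewrite (leq_trans le).
Qed.

Lemma rooted_dec_setI e e' n Y R W :
    (forall x y, x \in Y :&: W -> y \in Y :&: W -> e' x y -> e x y) ->
  rooted_dec e n Y R -> rooted_dec e' n (Y :&: W) (R :&: W).
Proof.
move=> e'e [T [root [par [rank [bag [par_rank Rroot bagn tops edges]]]]]].
exists T, root, par, rank, (fun t => bag t :&: W); split=> //.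
- exact: setSI.
- move=> t; have [le sub] := bagn t; rewrite setSI //; split=> //.
  by apply: leq_trans le; apply/subset_leq_card/subsetIl.
- move=> v /setIP[vY vW]; have [top vtop htop] := tops v vY.
  exists top; first by rewrite inE vtop.
  by move=> t /setIP[vt _] /(htop t vt)[-> vp]; rewrite inE vp.
- move=> x y xYW yYW /(e'e x y xYW yYW); case/setIP:
  xYW yYW => xY xW /setIP[yY yW].
  by case/(edges x y xY yY)=> t xt yt; exists t; rewrite inE ?xt ?yt.
Qed.

Lemma rooted_dec_setU e n Y R Z : symmetric e ->
  rooted_dec e n Y R -> rooted_dec e (n + #|Z|) (Y :|: Z) (R :|: Z).
Proof.
move=> sym_e [T [root [par [rank [bag [par_rank Rroot bagn tops edges]]]]]].
have cover v : v \in Y :|: Z -> exists t, v \in bag t :|: Z.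
  case/setUP=> [/tops[t vt _]|vZ]; first by exists t; rewrite inE vt.
  by exists root; rewrite inE vZ orbT.
exists T, root, par, rank, (fun t => bag t :|: Z); split=> //.
- exact: setSU.
- move=> t; have [le sub] := bagn t; rewrite setSU //; split=> //.
  by apply: leq_trans (leq_card_setU _ _) _; rewrite leq_add2r.
- move=> v vYZ; have [vZ|vZ] := boolP (v \in Z).
    by exists root => [|t _ ->]; rewrite inE vZ orbT.
  have vY : v \in Y by case/setUP: vYZ vZ => // ->.
  have [top vtop htop] := tops v vY; exists top; first by rewrite inE vtop.
  move=> t; rewrite !inE (negbTE vZ) !orbF; exact: htop.
- move=> x y xYZ yYZ exy.
  have [xZ|xZ] := boolP (x \in Z).
    by have [t yt] := cover y yYZ; exists t; rewrite // inE xZ orbT.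
  have [yZ|yZ] := boolP (y \in Z).
    by have [t xt] := cover x xYZ; exists t; rewrite // inE yZ orbT.
  have xY : x \in Y by case/setUP: xYZ xZ => // ->.
  have yY : y \in Y by case/setUP: yYZ yZ => // ->.
  by have [t xt yt] := edges x y xY yY exy; exists t; rewrite inE ?xt ?yt.
Qed.

(** The root of the second decomposition becomes a child of the first root. *)
Lemma rooted_dec_attach e n Y1 Y2 R1 R2 : symmetric e ->
    Y1 :&: Y2 \subset R1 -> Y1 :&: Y2 \subset R2 ->
    (forall x y, x \in Y1 -> y \in Y2 -> e x y -> x \in Y2 \/ y \in Y1) ->
  rooted_dec e n Y1 R1 -> rooted_dec e n Y2 R2 -> rooted_dec e n (Y1 :|: Y2) R1.
Proof.
move=> sym_e /subsetP sub1 /subsetP sub2 cut12.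
move=> [T1 [root1 [par1 [rank1 [bag1 [[pr1 rk1] Rr1 bagn1 tops1 edges1]]]]]].
move=> [T2 [root2 [par2 [rank2 [bag2 [[pr2 rk2] Rr2 bagn2 tops2 edges2]]]]]].
pose par (t : T1 + T2) := match t with
  | inl t1 => inl (par1 t1)
  | inr t2 => if t2 == root2 then inl root1 else inr (par2 t2) end.
pose rank (t : T1 + T2) := match t with
  | inl t1 => rank1 t1 | inr t2 => (rank1 root1 + rank2 t2).+1 end.
pose bag (t : T1 + T2) := match t with inl t1 => bag1 t1 | inr t2 => bag2 t2
  end.
exists (T1 + T2)%type, (inl root1), par, rank, bag; split=> //.
- split; first by rewrite /= pr1.
  case=> [t1|t2] /=; first by move=> t1r; apply: rk1.
  move=> _; case: eqP => [_|/eqP/rk2 lt] /=; first by rewrite ltnS leq_addr.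
  by rewrite ltnS ltn_add2l.
- case=> t; [case: (bagn1 t)|case: (bagn2 t)] => le sub; split=> //;
    by apply: subset_trans sub _; rewrite ?subsetUl ?subsetUr.
- move=> v vY; have [v1|v1] := boolP (v \in Y1).
    have [top vtop htop] := tops1 v v1; exists (inl top) => //.
    case=> t /= vt ttop.
      by have [] := htop t vt; first by apply: contraNneq ttop => ->.
    have v2 : v \in Y2 by have [_ /subsetP] := bagn2 t; apply.
    have v12 : v \in Y1 :&: Y2 by rewrite inE v1.
    split=> //; case: eqP => [_|/eqP tr] /=; first exact/(subsetP Rr1)/sub1.
    have [top2 vtop2 htop2] := tops2 v v2.
    have rtop2 : root2 = top2.
      apply/eqP; apply: contraT => /htop2[|]; last by rewrite eqxx.
      exact/(subsetP Rr2)/sub2.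
    by have [] := htop2 t vt; rewrite -?rtop2.
  have v2 : v \in Y2 by case/setUP: vY v1 => // ->.
  have [top vtop htop] := tops2 v v2; exists (inr top) => //.
  case=> t /= vt ttop.
    by case/negP: v1; have [_ /subsetP] := bagn1 t; apply.
  have [|tr vp] := htop t vt; first by apply: contraNneq ttop => ->.
  by rewrite (negbTE tr).
- have in1 x y : x \in Y1 -> y \in Y1 -> e x y -> exists2 t,
  x \in bag t & y \in bag t.
    by move=> x1 y1 /(edges1 x y x1 y1)[t xt yt]; exists (inl t).
  have in2 x y : x \in Y2 -> y \in Y2 -> e x y -> exists2 t,
    x \in bag t & y \in bag t.
    by move=> x2 y2 /(edges2 x y x2 y2)[t xt yt]; exists (inr t).
  move=> x y /setUP[x1|x2] /setUP[y1|y2] exy; [exact: in1| | |exact: in2].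
    by have [x2|y1] := cut12 x y x1 y2 exy; [apply: in2|apply: in1].
  have [|y2|x1] := cut12 y x y1 x2; [by rewrite sym_e|exact: in2|exact: in1].
Qed.

Lemma rooted_dec_bigcup e n (I : finType) (X : {set I}) (Y R : I -> {set V}) :
    symmetric e ->
    (forall i, i \in X -> rooted_dec e n (Y i) (R i)) ->
    (forall i j, i \in X -> j \in X -> i != j -> [disjoint Y i & Y j]) ->
    (forall i j x y, i \in X -> j \in X -> x \in Y i -> y \in Y j -> e x y -> i
      = j) ->
  rooted_dec e n (\bigcup_(i in X) Y i) set0.
Proof.
move=> sym_e; have [m] := ubnP #|X|; elim: m X => // m IHm X ltX decX disX
  edgeX.
have [->|[i iX]] := set_0Vmem X.
  by rewrite big_set0; apply: rooted_dec_bag; rewrite cards0.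
rewrite (big_setD1 i iX) /= setUC.
have sX j : j \in X :\ i -> j \in X by case/setD1P.
have I0 : (\bigcup_(j in X :\ i) Y j) :&: Y i = set0.
  apply/setP=> x; rewrite [RHS]inE; apply/negP=> /setIP[].
  move=> /bigcupP[j /setD1P[ji jX] xj] xi.
  by move/pred0P: (disX j i jX iX ji) => /(_ x) /=; rewrite xi xj.
apply: (@rooted_dec_attach _ _ _ _ _ set0); rewrite ?I0 ?sub0set //.
- move=> x y /bigcupP[j /setD1P[ji jX] xj] yi exy.
  by move: ji; rewrite (edgeX j i x y) ?eqxx.
- apply: IHm => [|j /sX|j k /sX jX /sX|j k x y /sX jX /sX kX].
  + by move: ltX; rewrite (cardsD1 i) iX.
  + exact: decX.
  + exact: disX.
  + exact: edgeX.
- by apply: rooted_decW (decX i iX) => //; apply: sub0set.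
Qed.

End RootedDecomposition.

Definition parent_adj (T : finType) (par : T -> T) : rel T :=
  fun t u => (t != u) && ((par t == u) || (par u == t)).

(** In a cycle both neighbours of a node of maximal rank are its parent. *)
Lemma tree_of_parent (T : finType) (root : T) (par : T -> T) (rank : T -> nat) :
    par root = root -> (forall t, t != root -> rank (par t) < rank t) ->
  is_tree (parent_adj par).
Proof.
move=> par_root rank_par; set e := parent_adj par.
have sym_e : symmetric e by move=> t u; rewrite /e /parent_adj eq_sym orbC.
have e_par t : t != root -> e t (par t).
  move=> tr; rewrite /e /parent_adj eqxx andbT.
  apply: contraTneq (rank_par t tr) => <-.
  by rewrite ltnn.
split=> //.
- by move=> t; rewrite /e /parent_adj eqxx.
- by apply/card_gt0P; exists root.
- have to_root t : connect e t root.
    have [n] := ubnP (rank t); elim: n t => // n IHn t ltn.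
    have [->|tr] := eqVneq t root; first exact: connect0.
    have tp : connect e t (par t) by apply: connect1; apply: e_par.
    apply: (connect_trans tp); apply: IHn.
    exact: leq_trans (rank_par t tr) ltn.
  move=> t u _ _; rewrite (eq_connect (e' := e)) => [|x y];
    last by rewrite /= !inE.
  apply: connect_trans (to_root t) _.
  by have -> : connect e root u = connect e u root by apply: sym_connect_sym.
move=> p /andP[cyc_p uniq_p].
case: p cyc_p uniq_p => // x0 p0; set p := x0 :: p0 => cyc_p uniq_p.
case: (@arg_maxnP _ x0 (mem p) rank (mem_head _ _)) => x xp max_x.
have e_max y : y \in p -> e x y -> y = par x.
  move=> yp /andP[xy /orP[/eqP//|/eqP yx]].
  have yr : y != root by apply: contraNneq xy => yr; rewrite -yx yr par_root.
  by have := leq_trans (rank_par y yr) (max_x y yp); rewrite yx ltnn.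
have [i p' rotE] := rot_to xp.
have sizep : size p = (size p').+1 by rewrite -(size_rot i p) rotE.
have mem_p' y : y \in p' -> y \in p.
  by move=> yp'; rewrite -(mem_rot i p) rotE inE yp' orbT.
move: cyc_p uniq_p; rewrite -(rot_cycle i) -(rot_uniq i) rotE sizep.
case: p' mem_p' {rotE sizep} => // y p' mem_p' /=.
rewrite rcons_path => /and3P[xy _ zx] /and3P[_ yp' _].
have {}zx : e x (last y p') by rewrite sym_e; exact: zx.
have : last y p' = y.
  by rewrite (e_max _ (mem_p' _ (mem_last _ _)) zx) -(e_max y _ xy) ?mem_p'
    ?mem_head.
case: p' yp' {mem_p' zx} => //= z p' /negP yp' lastE.
by case: yp'; rewrite -{1}lastE mem_last.
Qed.

Lemma tw_of_rooted_dec (G : mgraph) n R :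
  rooted_dec (@adj G) n [set: vertex G] R -> (tw G < n%:Z)%R.
Proof.
case=> T [root [par [rank [bag [[pr rk] Rroot bagn tops edges]]]]].
have treeT := tree_of_parent pr rk.
have decG : tree_decomposition (parent_adj par) bag.
  split=> //.
  - by move=> v; have [t vt _] := tops v (in_setT v); exists t.
  - move=> d; have /eqP/cards2P[x [y [xy dE]]] := card_ends d.
    have exy : adj x y by apply/adjP; exists d.
    have [t xt yt] := edges x y (in_setT x) (in_setT y) exy.
    by exists t; rewrite dE subUset !sub1set xt.
  move=> v; have [top vtop htop] := tops v (in_setT v).
  apply/connectedP=> P s sv sP closP.
  have to_top t : v \in bag t -> (t \in P <-> top \in P).
    have [m] := ubnP (rank t); elim: m t => // m IHm t ltm vt.
    have [->//|ttop] := eqVneq t top.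
    have [tr vp] := htop t vt ttop.
    have tp : parent_adj par t (par t).
      rewrite /parent_adj eqxx andbT.
      by apply: contraTneq (rk t tr) => <-; rewrite ltnn.
    have pt : parent_adj par (par t) t by rewrite /parent_adj eq_sym orbC.
    rewrite -(IHm (par t)) //; last exact: leq_trans (rk t tr) ltm.
    by split=> ?; [apply: (closP t)|apply: (closP (par t))]; rewrite ?inE.
  apply/subsetP=> t; rewrite inE => vt; apply/(to_top t vt)/(to_top s) => //.
  by move: sv; rewrite inE.
rewrite /tw; case: ex_minnP => m _ minm.
have /minm le : `[< has_decomposition G (\max_(t : T) #|bag t|) >].
  by apply/asboolP; exists T, (parent_adj par), bag.
have : m <= n by apply: leq_trans le _; apply/bigmax_leqP => t _; case:
  (bagn t).
lia.
Qed.

(** * Subgraphs avoiding a set of vertices *)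

Section Avoid.
Variables (r : nat) (V : finType) (e e' : rel V) (S : {set V}).
Hypotheses (r_gt0 : 0 < r) (e'P : forall x y, e' x y -> [/\ x \notin S,
  y \notin S & e x y]).
Implicit Types (A B W : {set V}).

Lemma connected_avoid A x : connected_in e' A -> x \in A -> x \notin S ->
  connected_in e A /\ A \subset ~: S.
Proof.
move=> /connectedP cA xA xS; split.
  apply/connectedP=> P s sA sP closP; apply: (cA P s) => // y z yA zA yP /e'P[_
    _].
  exact: closP.
by apply: (cA (~: S) x) => // [|y z yA zA yP /e'P[_ zS _]]; rewrite inE.
Qed.

Lemma theta_on_avoid A B : theta_on r e' A B ->
  theta_on r e A B /\ A :|: B \subset ~: S.
Proof.
case=> cA cB dAB leAB; have /card_gt0P[p] := leq_trans r_gt0 leAB.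
rewrite inE => /and3P[pA pB /e'P[p1S p2S _]].
have [cA' AS] := connected_avoid cA pA p1S.
have [cB' BS] := connected_avoid cB pB p2S.
rewrite subUset AS; split=> //; split=> //; apply: leq_trans leAB _.
apply: subset_leq_card; apply/subsetP=> p'; rewrite !inE => /and3P[-> ->].
by case/e'P.
Qed.

(** A theta contains an edge, hence lies outside [S] when the vertices of [S]
    are isolated. *)
Lemma packs_avoid k W : packs r e' k W -> packs r e k (W :\: S).
Proof.
elim: k W => //= k IHk W [A [B [AW BW /theta_on_avoid[thAB ABS] /IHk pk]]].
move: ABS; rewrite subUset => /andP[AS BS].
exists A, B; split=> //; first by rewrite setDE subsetI AW.
  by rewrite setDE subsetI BW.
by rewrite setDDl setUC -setDDl.
Qed.

End Avoid.

(** * Coarsest partitions into pieces with small boundary *)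

Section Partition.
Variables (b : nat) (V : finType) (e : rel V).
Hypotheses (b_gt0 : 0 < b) (sym_e : symmetric e).
Implicit Types (Y : {set V}).

(** The inner boundary: deleting it separates the rest of [Y] from the
    complement of [Y], at a cost that does not depend on the degrees. *)
Definition boundary Y := [set x in Y | [exists y, (y \notin Y) && e x y]].

Lemma boundary_sub Y : boundary Y \subset Y.
Proof. by apply/subsetP=> x; rewrite inE => /andP[]. Qed.

Lemma mem_boundary Y x y : x \in Y -> y \notin Y -> e x y -> x \in boundary Y.
Proof. by move=> xY yY exy; rewrite inE xY; apply/existsP; exists y;
  rewrite yY. Qed.

Lemma boundaryU_sub Y1 Y2 : boundary (Y1 :|: Y2) \subset boundary Y1 :|:
  boundary Y2.
Proof.
apply/subsetP=> x; rewrite inE => /andP[xY /existsP[y]].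
rewrite inE negb_or -andbA => /and3P[y1 y2 exy]; rewrite inE.
by case/setUP: xY => xY; rewrite (mem_boundary xY _ exy) ?orbT.
Qed.

Definition piece Y := [/\ connected_in e Y, #|boundary Y| <= b
  & rooted_dec e b.*2 Y (boundary Y)].

Lemma piece0 : piece set0.
Proof.
have bd0 : boundary set0 = set0 by apply/eqP; rewrite -subset0 boundary_sub.
split; rewrite ?bd0 ?cards0 //; first by move=> x y; rewrite inE.
by apply: rooted_dec_bag; rewrite cards0.
Qed.

Lemma piece1 x : piece [set x].
Proof.
have le1 : #|boundary [set x]| <= 1 by rewrite -(cards1 x);
  apply/subset_leq_card/boundary_sub.
split; [exact: connected1|exact: leq_trans b_gt0|].
apply: (rooted_decW (leqnn _) (boundary_sub _)).
by apply: rooted_dec_bag; rewrite cards1 double_gt0.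
Qed.

(** A new root bag consisting of the two boundaries joins the two
    decompositions; this is where the bound [b.*2] on bags comes from. *)
Lemma pieceU Y1 Y2 x y : [disjoint Y1 & Y2] -> x \in Y1 -> y \in Y2 -> e x y ->
  #|boundary (Y1 :|: Y2)| <= b -> piece Y1 -> piece Y2 -> piece (Y1 :|: Y2).
Proof.
move=> dis xY1 yY2 exy leb [c1 b1 dec1] [c2 b2 dec2]; split=> //.
  by apply: (connectedU (x := x)) => //; right; exists y.
have no12 z : z \in Y1 -> z \in Y2 -> False.
  by move=> z1 z2; move/pred0P: dis => /(_ z) /=; rewrite z1 z2.
have sub1 := subsetP (boundary_sub Y1); have sub2 := subsetP (boundary_sub Y2).
pose B := boundary Y1 :|: boundary Y2.
have decB : rooted_dec e b.*2 B B.
  by apply: rooted_dec_bag; rewrite -addnn (leq_trans (leq_card_setU _ _))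
    ?leq_add.
have decB1 : rooted_dec e b.*2 (B :|: Y1) B.
  apply: rooted_dec_attach decB dec1 => //; first exact: subsetIl.
    apply/subsetP=> z /setIP[/setUP[//|/sub2 z2] z1]; by case: (no12 z).
  move=> z t /setUP[/sub1|/sub2 z2 t1 zt]; first by left.
  right; rewrite inE (mem_boundary t1 _ (y := z)) // 1?sym_e //.
  by apply/negP=> z1; apply: (no12 z).
have decB12 : rooted_dec e b.*2 ((B :|: Y1) :|: Y2) B.
  apply: rooted_dec_attach decB1 dec2 => //.
  - by apply/subsetP=> z /setIP[/setUP[//|z1] z2]; case: (no12 z).
  - apply/subsetP=> z /setIP[/setUP[/setUP[/sub1|//]|] z1 z2]; by case:
    (no12 z).
  - move=> z t zBY t2 zt; have [z2|z2] := boolP (z \in Y2); [by left|right].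
    by rewrite !inE; have := mem_boundary t2 z2; rewrite sym_e inE => ->;
      rewrite ?orbT.
have -> : Y1 :|: Y2 = (B :|: Y1) :|: Y2.
  rewrite -setUA; apply/esym/setUidPr; rewrite subUset.
  by rewrite (subset_trans (boundary_sub Y1)) ?subsetUl // (subset_trans
    (boundary_sub Y2)) ?subsetUr.
apply: rooted_decW decB12 => //.
by apply: subset_trans (boundaryU_sub _ _); rewrite -setUA (setUidPr _) //
  subUset;
  rewrite (subset_trans (boundary_sub Y1)) ?subsetUl // (subset_trans
    (boundary_sub Y2)) ?subsetUr.
Qed.

Definition fibre (c : V -> V) i : {set V} := c @^-1: [set i].

Lemma mem_fibre c i x : (x \in fibre c i) = (c x == i).
Proof. by rewrite !inE. Qed.

(** In a partition with fewest parts no two adjacent pieces can be merged, and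
    by [pieceU] only the size of the boundary can prevent it. *)
Lemma coarsest_partition : exists c : V -> V,
  (forall i, piece (fibre c i)) /\
  (forall i j, qrel e c i j -> b < #|boundary (fibre c i :|: fibre c j)|).
Proof.
pose P (c : {ffun V -> V}) := `[< forall i, piece (fibre c i) >].
have P_id : P [ffun x => x].
  apply/asboolP=> i; have -> : fibre [ffun x => x] i = [set i].
    by apply/setP=> x; rewrite !inE ffunE.
  exact: piece1.
case: (arg_minnP (fun c : {ffun V -> V} => #|c @:
  setT|) P_id) => c /asboolP pc minc.
exists c; split=> // i j /qrelP[ij [x [y [xi yj exy]]]].
rewrite ltnNge; apply/negP=> leb.
pose c' := [ffun z => if c z == j then i else c z].
have : P c'.
  apply/asboolP=> l; have [->|lj] := eqVneq l j.
    have -> : fibre c' j = set0.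
      apply/setP=> z; rewrite mem_fibre ffunE [RHS]inE; case: ifP => [_|//].
      exact/negbTE.
    exact: piece0.
  have [->|li] := eqVneq l i.
    have -> : fibre c' i = fibre c i :|: fibre c j.
      apply/setP=> z; rewrite in_setU !mem_fibre ffunE orbC; case: ifP => // _.
      by rewrite eqxx.
    apply: (pieceU (x := x) (y := y)) => //; rewrite ?mem_fibre ?xi ?yj //.
    rewrite -setI_eq0; apply/eqP/setP=> z; rewrite !inE; apply/negP.
    by case/andP=> /eqP-> ; apply/negP.
  have -> : fibre c' l = fibre c l => //.
  apply/setP=> z; rewrite !mem_fibre ffunE; case: ifP => // /eqP->.
  by rewrite eq_sym (negbTE li) eq_sym (negbTE lj).
move=> /minc; rewrite leqNgt => /negP[]; apply: proper_card.
apply/properP; split.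
  apply/subsetP=> _ /imsetP[z _ ->]; rewrite ffunE; case: ifP => _; last exact:
    imset_f.
  by rewrite -xi imset_f.
exists j; first by rewrite -yj imset_f.
apply/imsetP=> -[z _]; rewrite ffunE; case: ifP => [_ /eqP|/eqP zj /esym //].
by rewrite eq_sym (negbTE ij).
Qed.

End Partition.

(** * A tree-decomposition in the absence of a packing *)

Section Main.
Variables (q d k : nat) (V : finType).
Hypotheses (q_gt0 : 0 < q) (dk : q * (k * q.+3) <= 2 ^ d).

(** Bound on the boundary of a piece, the parameter [b] above. *)
Definition border_cap := 6 * q ^ 3.
(** Size below which thetas are excluded: [lift_theta] turns a theta of size
    [(q.+1 * d.*2).+1.*2], the bound of [packs_of_no_small_theta], into one of
    this size. *)
Definition model_cap := 3 * (q.+1 * d.*2).+1.*2 + 2 * q.+1.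

(** Either a theta lies in few pieces, whose boundaries [Z] are deleted and
    then added to all bags, or the quotient by the pieces satisfies the
    hypotheses of [packs_of_heavy_edges]; if the quotient has no edge, the
    pieces are unions of components and their decompositions suffice. *)
Lemma decomposition_of_no_packing j (e : rel V) : j <= k ->
    symmetric e -> irreflexive e -> ~ packs q.+1 e j [set: V] ->
  rooted_dec e (border_cap.*2 + j * (model_cap * border_cap)) [set: V] set0.
Proof.
elim: j e => [|j IHj] e jk sym_e irr_e nopack; first by case: nopack.
have b_gt0 : 0 < border_cap by rewrite muln_gt0 expn_gt0 q_gt0.
have [c [pc coarse]] := coarsest_partition b_gt0 sym_e.
pose M := qrel e c.
have disF i l x : x \in fibre c i -> x \in fibre c l -> i = l.
  by rewrite !mem_fibre => /eqP-> /eqP.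
have [[Q [leQ [A [B [AQ BQ thAB]]]]]|nosmall] := pselect (exists Q : {set V},
  #|Q| <= model_cap /\
    exists A B : {set V}, [/\ A \subset c @^-1: Q, B \subset c @^-1:
      Q & theta_on q.+1 e A B]).
  pose S := c @^-1: Q; pose Z := \bigcup_(i in Q) boundary e (fibre c i).
  have leZ : #|Z| <= model_cap * border_cap.
    apply: leq_trans (card_bigcup_leq (n := border_cap) _) _.
      by move=> i _; case: (pc i).
    by rewrite leq_mul2r leQ orbT.
  pose e' := [rel x y | [&& x \notin S, y \notin S & e x y]].
  have e'P x y : e' x y -> [/\ x \notin S, y \notin S & e x y] by case/and3P.
  have dec_e' : rooted_dec e' (border_cap.*2 + j * (model_cap * border_cap))
    [set: V] set0.
    apply: IHj => [||x|pk]; first exact: ltnW.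
    - by move=> x y; rewrite /= sym_e andbCA.
    - by rewrite /= irr_e !andbF.
    apply: nopack; exists A, B; split=> //; try exact: subsetT.
    apply: packs_sub (packs_avoid (ltn0Sn q) e'P pk).
    by rewrite setDS // subUset AQ.
  set N := _ + _ in dec_e'.
  have decS : rooted_dec e N (~: S) set0.
    have := rooted_dec_setI (e' := e) (W := ~: S) _ dec_e';
      rewrite setTI set0I; apply.
    by move=> x y; rewrite !in_setC => xS yS exy; apply/and3P.
  have inner i x y : x \in fibre c i :&: ~: Z -> i \in Q -> e x y -> y \in
    fibre c i.
    case/setIP=> xi; rewrite inE => xZ iQ exy; apply: contraNT xZ => yi.
    by apply/bigcupP; exists i => //; apply: mem_boundary exy.
  have decQ : rooted_dec e N (\bigcup_(i in Q) (fibre c i :&: ~: Z)) set0.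
    apply: (rooted_dec_bigcup (R := fun i => boundary e (fibre c i) :&: ~:
      Z)) => //.
    - move=> i _; apply: rooted_decW (leq_addr _ _) (subxx _) _.
      by apply: (rooted_dec_setI (e := e)) => //; case: (pc i).
    - move=> i l iQ lQ; apply: contraNT => /pred0Pn[x /andP[/setIP[xi _]
      /setIP[xl _]]].
      by apply/eqP; apply: disF xi xl.
    - move=> i l x y iQ lQ xi /setIP[yl _] /(inner i x y xi iQ) yi.
      exact: disF yi yl.
  have S_Q : \bigcup_(i in Q) (fibre c i :&: ~: Z) \subset S.
    by apply/bigcupsP=> i iQ; apply/subsetP=> x /setIP[];
      rewrite mem_fibre !inE => /eqP->.
  have dis : ~: S :&: \bigcup_(i in Q) (fibre c i :&: ~: Z) = set0.
    apply/setP=> x; rewrite [RHS]inE; apply/negP=> /setIP[];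
      rewrite inE => /negP xS.
    by move/(subsetP S_Q).
  have := rooted_dec_attach sym_e _ _ _ decS decQ;
    rewrite dis !sub0set => /(_ isT isT) dec.
  have {dec} /(rooted_dec_setU Z sym_e) : rooted_dec e N (~: S :|:
    \bigcup_(i in Q) (fibre c i :&: ~: Z)) set0.
    apply: dec => x y xS /bigcupP[i iQ yi]; rewrite sym_e => /(inner i y x yi
      iQ).
    by rewrite mem_fibre => /eqP xi; move: xS; rewrite !inE xi iQ.
  have -> : ~: S :|: \bigcup_(i in Q) (fibre c i :&: ~: Z) :|: Z = [set: V].
    apply/setP=> x; rewrite [RHS]inE; have [xZ|xZ] := boolP (x \in Z);
      first by rewrite inE xZ orbT.
    have [xS|xS] := boolP (x \in S); last by rewrite !in_setU in_setC xS.
    rewrite inE; apply/orP; left; rewrite inE; apply/orP; right.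
    by apply/bigcupP; exists (c x); [rewrite inE in xS|rewrite inE mem_fibre
      eqxx inE].
  apply: rooted_decW; last exact: sub0set.
  by rewrite /N -addnA leq_add2l mulSn addnC leq_add2r.
have {}nosmall (Q A B : {set V}) : #|Q| <= model_cap -> A \subset c @^-1:
  Q -> B \subset c @^-1: Q ->
    theta_on q.+1 e A B -> False.
  by move=> leQ AQ BQ thAB; apply: nosmall; exists Q; split=> //; exists A, B.
have conn i : connected_in e (c @^-1: [set i]) by case: (pc i).
have [[i0 [j0 M0]]|noedge] := pselect (exists i j, M i j); last first.
  have -> : [set: V] = \bigcup_(i in [set: V]) fibre c i.
    apply/setP=> x; rewrite inE; apply/esym/bigcupP; exists (c x) => //.
    by rewrite mem_fibre.
  apply: (rooted_dec_bigcup (R := fun i => boundary e (fibre c i))) => //.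
  - by move=> i _; apply: rooted_decW (leq_addr _ _) (subxx _) _; case: (pc i).
  - move=> i l _ _; apply: contraNT => /pred0Pn[x /andP[xi xl]].
    by apply/eqP; apply: disF xi xl.
  - move=> i l x y _ _; rewrite !mem_fibre => /eqP xi /eqP yl exy.
    apply/eqP; apply: contraT => il; case: noedge; exists i, l.
    by apply/qrelP; split=> //; exists x, y.
case: nopack; apply: (packs_sub (W := c @^-1: [set: V])); first exact: subsetT.
apply: (packs_preim conn); apply: (packs_of_heavy_edges (d := d)) => //.
- exact: qrel_sym.
- exact: qrel_irr.
- move=> i l il; pose Y := fibre c i :|: fibre c l.
  pose N := [set m in [set: V] | M i m] :|: [set m in [set: V] | M l m].
  apply: leq_trans (leq_card_setU _ _); rewrite -/N -(leq_pmul2r q_gt0).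
  apply: leq_trans (_ : #|boundary e Y| <= _).
    by have := coarse i l il; rewrite /border_cap expnSr mulnA => /ltnW.
  pose N' := N :\: [set i; l].
  apply: leq_trans (_ : #|N'| * q <= _); last first.
    by rewrite leq_mul2r subset_leq_card ?subsetDl ?orbT.
  case/qrelP: (il) => il_neq [x0 [y0 [x0i y0l ex0y0]]].
  have connY : connected_in e Y.
    apply: (connectedU (x := x0)) => //; [exact: conn|exact: conn| |right].
      by rewrite mem_fibre x0i.
    by exists y0; rewrite // mem_fibre y0l.
(* Otherwise [Y] and the piece [m] form a theta inside three pieces. *)
  have le_cross m : m \in N' -> #|cross e Y (fibre c m)| <= q.
    case/setDP=> _; rewrite !inE negb_or => /andP[mi ml].
    rewrite -ltnS ltnNge; apply/negP=> ltc.
    apply: (nosmall [set i; l; m] Y (fibre c m)).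
    + apply: leq_trans (_ : 3 <= _); last by rewrite /model_cap; lia.
      apply: leq_trans (leq_card_setU _ _) _; rewrite cards1 cards2.
      by case: (i != l).
    + by apply/subsetP=> x; rewrite in_setU !mem_fibre !inE => /orP[]->;
      rewrite ?orbT.
    + by apply/subsetP=> x; rewrite mem_fibre !inE => ->; rewrite orbT.
    split=> //; first exact: conn.
    rewrite -setI_eq0; apply/eqP/setP=> x; rewrite [RHS]inE; apply/negP.
    case/setIP; rewrite in_setU !mem_fibre => xil /eqP xm.
    by move: xil; rewrite xm (negbTE mi) (negbTE ml).
  apply: leq_trans (card_bigcup_leq le_cross).
  rewrite -(card_in_imset (f := fun x => (x, odflt x [pick y | (y \notin Y) &&
    e x y]))).
    apply: subset_leq_card; apply/subsetP=> _ /imsetP[x xbd ->].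
    have xY := subsetP (boundary_sub e Y) x xbd; move: xbd; rewrite inE.
    case/andP=> _ /existsP[y0' y0'P]; case: pickP => [y /andP[yY exy] /=|/(_
      y0')]; last first.
      by rewrite y0'P.
    move: (yY); rewrite in_setU !mem_fibre negb_or => /andP[yi yl].
    apply/bigcupP; exists (c y); last by rewrite inE /= xY mem_fibre eqxx.
    rewrite !inE negb_or yi yl /=.
    move: xY; rewrite in_setU !mem_fibre => /orP[/eqP xi|/eqP xl]; apply/orP;
      [left|right];
      by apply/qrelP; rewrite eq_sym; split=> //; exists x, y.
  by move=> x x' _ _ [].
- move=> i l il; apply: contrapT => noz.
  have := coarse i l il; rewrite ltnNge => /negP[].
  have [_ le _] := pc l; apply: leq_trans le; apply: subset_leq_card.
  apply/subsetP=> x xbd.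
  have xY := subsetP (boundary_sub e _) x xbd; move: xbd; rewrite inE.
  case/andP=> _ /existsP[y /andP[]]; rewrite in_setU !mem_fibre negb_or =>
    /andP[yi yl] exy.
  move: xY; rewrite in_setU => /orP[|xl]; last by apply: mem_boundary exy;
    rewrite // mem_fibre.
  rewrite mem_fibre => /eqP xi; case: noz; exists (c y) => //.
  by apply/qrelP; rewrite eq_sym; split=> //; exists x, y.
- by exists i0, j0.
- by apply: leq_trans dk; rewrite leq_mul2l leq_mul2r jk !orbT.
- move=> A B thAB leAB; apply: (nosmall (A :|: B) (c @^-1: A) (c @^-1: B)).
  + by apply: leq_trans (leq_card_setU _ _) leAB.
  + by apply: preimsetS; apply: subsetUl.
  + by apply: preimsetS; apply: subsetUr.
  exact: theta_on_preim.
Qed.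

End Main.

(** * Numerical bounds *)

(** As [q.+1 <= 2 ^ q], both sides compare with powers of [2 ^ q]; this leaves
    the case [q = 1], where the left side is 648 and the right side 4096. *)
Lemma exp_bound q : 0 < q ->
  6 * q ^ 3 * (24 * q.+1 ^ 2 + 2 * q + 10) <= 2 ^ (6 * q.+1).
Proof.
case: q => [//|[//|q]] _; set p := q.+2.
have -> : 2 ^ (6 * p.+1) = 64 * (2 ^ p) ^ 6.
  by rewrite mulnS expnD -expnM mulnC [p * 6]mulnC mulnC.
have px : p < 2 ^ p by apply: ltn_expl.
have x4 : 4 <= 2 ^ p by rewrite -[4]/(2 ^ 2) leq_exp2l.
move: (2 ^ p) px x4 => x px x4.
have h1 : 24 * p.+1 ^ 2 + 2 * p + 10 <= 36 * x ^ 2.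
  have : p.+1 ^ 2 <= x ^ 2 by rewrite leq_exp2r.
  have : x * 1 <= x * x by rewrite leq_mul2l; lia.
  rewrite -mulnn; lia.
have h2 : q.+2 ^ 3 <= x ^ 3 by rewrite leq_exp2r // ltnW.
apply: leq_trans (leq_mul (leq_mul (leqnn 6) h2) h1) _.
rewrite mulnACA -expnD (expnS x 5) mulnA leq_mul2r; apply/orP; right.
by apply: leq_trans (leq_mul (leqnn 64) x4).
Qed.

Lemma model_cap_bound q l : 0 < l ->
  model_cap q (l.+1 + 2 * q) <= l * (24 * q.+1 ^ 2 + 2 * q + 8).
Proof.
case: l => // l _; rewrite /model_cap.
have -> : 3 * (q.+1 * (l.+2 + 2 * q).*2).+1.*2 + 2 * q.+1
  = 12 * q.+1 * (l.+2 + 2 * q) + 2 * q + 8 by lia.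
have : l.+2 + 2 * q <= l.+1 * (2 * q.+1) by nia.
move/(leq_mul (leqnn (12 * q.+1))) => le.
rewrite -addnA mulnDr mulSn in le *; nia.
Qed.

Lemma decomposition_bound q k l : 0 < q -> 0 < k -> 0 < l ->
  (border_cap q).*2 + k * (model_cap q (l.+1 + 2 * q) * border_cap q)
    <= 2 ^ (6 * q.+1) * k * l.
Proof.
move=> q_gt0 k_gt0 l_gt0.
rewrite -mulnA; apply: leq_trans (leq_mul (exp_bound q_gt0) (leqnn (k * l))).
rewrite -/(border_cap q).
have -> : border_cap q * (24 * q.+1 ^ 2 + 2 * q + 10) * (k * l) =
  border_cap q * 2 * (k * l) + k * (l * (24 * q.+1 ^ 2 + 2 * q + 8) *
    border_cap q) by lia.
apply: leq_add.
  by rewrite -muln2 leq_pmulr // muln_gt0 k_gt0.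
by rewrite leq_mul2l leq_mul2r model_cap_bound ?orbT.
Qed.

Lemma depth_bound q k l : 0 < q -> k < 2 ^ l.+1 ->
  q * (k * q.+3) <= 2 ^ (l.+1 + 2 * q).
Proof.
move=> q_gt0 ltk; rewrite expnD mulnCA; apply: leq_mul; first exact: ltnW.
elim: q q_gt0 => // q IHq _; case: q IHq => // q IHq.
apply: leq_trans (_ : 4 * (q.+1 * q.+4) <= _); first by nia.
by rewrite [2 * _]mulnS expnD leq_mul // IHq.
Qed.

Import Order.TTheory GRing.Theory Num.Theory.
Local Open Scope ring_scope.

Lemma trunc_log_le_log2 (R : realType) n : (0 < n)%N ->
  (trunc_log 2 n)%:R <= log2 n%:R :> R.
Proof.
move=> n_gt0; rewrite /log2 ler_pdivlMr ?ln_gt0 ?ltr1n //.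
rewrite mulr_natl -lnXn ?ltr0n // ler_ln ?posrE ?exprn_gt0 ?ltr0n //.
by rewrite -natrX ler_nat trunc_logP.
Qed.

(** * Treewidth and packings of theta graphs *)
Theorem theorem5p1 (R : realType) (G : mgraph) (r k : nat)
    (hr : (2 <= r)%N) (hk : (1 <= k)%N)
    (htw : 2 ^+ (6 * r) * k%:R * log2 (k%:R + 1) <= (tw G)%:~R :> R) :
  minor (copies k (theta r)) G.
Proof.
case: r hr htw => [|q] // q_gt0 htw; apply: contrapT => nominor.
(* [l] is a lower bound for the binary logarithm of [k + 1]; in the depth
   [l.+1 + 2 * q], the power [4 ^ q] absorbs the factors of [dk] that depend
   on [r]. *)
pose l := trunc_log 2 k.+1.
have l_gt0 : (0 < l)%N by rewrite trunc_log_gt0.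
have dk : (q * (k * q.+3) <= 2 ^ (l.+1 + 2 * q))%N.
  by apply: depth_bound => //; apply: ltn_trans (trunc_log_ltn _ _).
have nopack : ~ packs q.+1 (@adj G) k [set: vertex G].
  by move=> pk; apply: nominor; apply: minor_of_packing pk.
have dec := decomposition_of_no_packing q_gt0 dk (leqnn k) (@adj_sym G)
  (@adj_irr G) nopack.
have twN : (tw G)%:~R < (2 ^ (6 * q.+1) * k * l)%:R :> R.
  rewrite -[X in _ < X]/((2 ^ (6 * q.+1) * k * l)%:Z%:~R) ltr_int.
  apply: lt_le_trans (tw_of_rooted_dec dec) _.
  by rewrite lez_nat decomposition_bound.
suff le_tw : (2 ^ (6 * q.+1) * k * l)%:R <= (tw G)%:~R :> R.
  by have := lt_le_trans twN le_tw; rewrite ltxx.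
apply: le_trans htw; rewrite !natrM natrX natr1 ler_wpM2l ?trunc_log_le_log2 //.
by rewrite mulr_ge0 ?exprn_ge0.
Qed.
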